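(* If each new threshold $s$ is chosen uniformly at random from among the set of choices, then incremental topological ordering by soft-threshold search takes $\mathrm{O}(m^{3/2})$ expected total time over $m$ arc additions.
   Context: Incremental setting: a fixed set of $n$ vertices, initially no arcs; $m$ distinct arcs are added one at a time, with $m=\Omega(n)$; processing stops once a cycle is detected. A total order $<$ of the vertices, topological for the current graph, is maintained in a dynamic ordered list supporting order queries, deletions, and insertions just before/after a given element in $\mathrm{O}(1)$ amortized time; each vertex has singly linked outgoing and incoming arc lists; all sets below are doubly linked lists with membership flags. When an arc $(v,w)$ is added: if $v<w$ do nothing; if $v>w$ run soft-threshold search (comparisons in the order before the addition): initialize $F=\{w\}$, $B=\{v\}$, $\mathit{out}(w)=$ first outgoing arc of $w$, $\mathit{in}(v)=$ first incoming arc of $v$ (null if none), $s=v$; $F_A=\{w\}$ if $\mathit{out}(w)\ne$ null else $\{\}$; $B_A=\{v\}$ if $\mathit{in}(v)\ne$ null else $\{\}$; $F_P=B_P=\{\}$. While $F_A\ne\{\}$ and $B_A\ne\{\}$: choose any $u\in F_A$, $z\in B_A$. If $u<z$: let $(u,x)=\mathit{out}(u)$, $(y,z)=\mathit{in}(z)$; advance $\mathit{out}(u)$, $\mathit{in}(z)$ to the next arcs on their lists (null if none); remove $u$ from $F_A$ if $\mathit{out}(u)$ is null and $z$ from $B_A$ if $\mathit{in}(z)$ is null; if $x\in B$ or $y\in F$, report a cycle and stop; if $x\notin F$, add $x$ to $F$, set $\mathit{out}(x)$ to its first outgoing arc and add $x$ to $F_A$ if non-null; if $y\notin B$, symmetrically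 with $\mathit{in}(y)$ and $B_A$. Otherwise: if $u>s$ move $u$ from $F_A$ to $F_P$; if $z<s$ move $z$ from $B_A$ to $B_P$. Then if $F_A=\{\}$: set $B_P=\{\}$, remove $s$ from $B_A$, and if $F_P\ne\{\}$ choose a new $s\in F_P$ (the set of choices is $F_P$) and move all $x\in F_P$ with $x\le s$ to $F_A$. If $B_A=\{\}$: set $F_P=\{\}$, remove $s$ from $F_A$, and if $B_P\ne\{\}$ choose a new $s\in B_P$ (the set of choices is $B_P$) and move all $x\in B_P$ with $x\ge s$ to $B_A$. If no cycle is reported, reorder: $t=\min(\{v\}\cup\{x\in F:\mathit{out}(x)\ne\text{null}\})$, $F_<=\{x\in F:x<t\}$, $B_>=\{y\in B:y>t\}$; if $t=v$ move $F_<$ just after $t$, else move $F_<$ just before $t$ and $B_>$ just before $F_<$; order each of $F_<$, $B_>$ internally topologically with a linear-time static algorithm.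
   Formalization: The cycle test is mended: a cycle is also reported when both traversed arcs reach the same new vertex x = y. With the literal test ''x in B or y in F'' the search never ends on arcs (w,x), (x,v), (v,w) with initial order w < x < v. *)

(* Defs.v *)
From HB Require Import structures.
From mathcomp Require Import all_boot all_order all_algebra.
From mathcomp Require Import reals exp.

Set Implicit Arguments.
Unset Strict Implicit.
Unset Printing Implicit Defensive.

Import GRing.Theory.

(* Finitely supported probability distributions, as lists of (weight, outcome)
   pairs; the same outcome may be listed several times, its weights add up. *)
Section Distributions.
Local Open Scope ring_scope.
Variable R : realType.

Definition dist (A : Type) := seq (R * A).

Definition dret {A : Type} (a : A) : dist A := [:: (1, a)].

Definition dbind {A B : Type} (d : dist A) (f : A -> dist B) : dist B :=
  flatten [seq [seq (p.1 * q.1, q.2) | q <- f p.2] | p <- d].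

Definition uniform {T : finType} (S : {set T}) : dist T :=
  [seq (#|S|%:R^-1, x) | x <- enum S].

Definition expectation {A : Type} (d : dist A) (X : A -> R) : R :=
  \sum_(p <- d) p.1 * X p.2.

Definition surely {A : Type} (d : dist A) (P : pred A) : bool :=
  all (fun p => P p.2) d.

End Distributions.

Section SoftThresholdSearch.
Variables (R : realType) (V : finType).

(* A total order of the vertices is a duplicate-free list of all of them. *)
Definition olt (ord : seq V) : rel V := fun x y => index x ord < index y ord.
Definition ole (ord : seq V) : rel V := fun x y => index x ord <= index y ord.

Definition topological (e : rel V) (S : {set V}) (l : seq V) : Prop :=
  perm_eq l (enum S) /\ {in S &, forall x y, e x y -> olt l x y}.

(* One of the two directions of a search.  For the forward side, [seen],
   [active], [passive] are F, F_A, F_P and [ptr x] is the part of the outgoing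
   arc list of x that starts at out(x), so that out(x) is null iff
   [ptr x = [::]].  For the backward side they are B, B_A, B_P and in.
   An arc on the list of x is represented by its other end. *)
Record side := Side {
  seen : {set V};
  active : {set V};
  passive : {set V};
  ptr : V -> seq V }.

Record search := Search {
  source : V; (* the tail v of the arc (v, w) being added *)
  fwd : side;
  bwd : side;
  threshold : V }.

Definition start_side (adj : V -> seq V) (x : V) : side :=
  Side [set x] (if nilp (adj x) then set0 else [set x]) set0
    [eta (fun=> [::]) with x |-> adj x].

Definition advance (x : V) (S : side) : side :=
  let rest := behead (ptr S x) in
  Side (seen S) (if nilp rest then active S :\ x else active S) (passive S)
    [eta ptr S with x |-> rest].

Definition discover (adj : V -> seq V) (x : V) (S : side) : side :=
  if x \in seen S then S else
  Side (x |: seen S) (if nilp (adj x) then active S else x |: active S)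
    (passive S) [eta ptr S with x |-> adj x].

Definition deactivate (x : V) (S : side) : side :=
  Side (seen S) (active S :\ x) (x |: passive S) (ptr S).

(* The update made when [active own] is empty, [le] being the order in the
   direction of [own].  The first component of the result is the time: the
   passive sets are emptied or scanned element by element. *)
Definition refill (le : rel V) (own other : side) (s : V) :
    dist R (nat * side * side * V) :=
  if active own != set0 then dret R (0, own, other, s) else
  let time := 1 + #|passive own| + #|passive other| in
  let other' := Side (seen other) (active other :\ s) set0 (ptr other) in
  if passive own == set0 then dret R (time, own, other', s) else
  dbind (uniform R (passive own)) (fun s' =>
    let own' := Side (seen own)
      [set x in passive own | le x s'] [set x in passive own | ~~ le x s']
      (ptr own) in
    dret R (time, own', other', s')).

Definition refill_both (ord : seq V) (sr : search) : dist R (nat * search) :=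
  dbind (refill (ole ord) (fwd sr) (bwd sr) (threshold sr))
    (fun '(t1, F1, B1, s1) =>
  dbind (refill (fun x y => ole ord y x) B1 F1 s1)
    (fun '(t2, B2, F2, s2) =>
  dret R (t1 + t2, Search (source sr) F2 B2 s2))).

Record config := Config {
  order : seq V;
  outs : V -> seq V;            (* outs x: heads of the outgoing arcs of x *)
  ins : V -> seq V;             (* ins x: tails of the incoming arcs of x *)
  todo : seq (V * V);           (* arcs still to be added *)
  searching : option search;
  cyclic : bool;                (* a cycle has been reported *)
  clock : nat }.

Definition init (ord : seq V) (arcs : seq (V * V)) : config :=
  Config ord (fun=> [::]) (fun=> [::]) arcs None false #|V|.

Definition halted (c : config) : bool :=
  cyclic c || (nilp (todo c) && ~~ isSome (searching c)).

Definition edge (c : config) : rel V := fun x y => y \in outs c x.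

(* A run up to some moment: the current configuration and the earlier ones,
   latest first. *)
Definition trace := (config * seq config)%type.

(* Everything the algorithm leaves open except the choice of the thresholds:
   the u and z chosen in an iteration, the end of the arc lists at which a new
   arc is linked, and the result of the static topological ordering algorithm.
   Each may depend on the whole past, in particular on past thresholds. *)
Record resolver := Resolver {
  pick : trace -> V * V;
  at_front : trace -> bool;
  static_sort : trace -> {set V} -> seq V }.

Definition admissible (r : resolver) : Prop :=
  (forall (tr : trace) (sr : search), searching tr.1 = Some sr ->
     active (fwd sr) != set0 -> active (bwd sr) != set0 ->
     (pick r tr).1 \in active (fwd sr) /\ (pick r tr).2 \in active (bwd sr)) /\
  (forall (tr : trace) (S : {set V}),
     (exists l, topological (edge tr.1) S l) ->
     topological (edge tr.1) S (static_sort r tr S)).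

(* Time is charged as follows, each unit standing for a bounded number of
   constant-time operations on arc lists, sets and the dynamic ordered list
   (whose operations are O(1) amortized): one unit per vertex initially, one
   per arc addition, one per search iteration, the time of [refill], and in
   the reordering one per vertex of F and B and per vertex and arc scanned by
   the static ordering algorithm. *)

Definition add_arc (front : bool) (v w : V) (arcs : seq (V * V)) (c : config) :
    config :=
  let link y (l : seq V) := if front then y :: l else rcons l y in
  let outs' := [eta outs c with v |-> link w (outs c v)] in
  let ins' := [eta ins c with w |-> link v (ins c w)] in
  let sr := if olt (order c) w v
    then Some (Search v (start_side outs' w) (start_side ins' v) v)
    else None in
  (* a loop is a cycle *)
  Config (order c) outs' ins' arcs sr (v == w) (clock c).+1.

Definition insert_before (t : V) (l ord : seq V) : seq V :=
  take (index t ord) ord ++ l ++ drop (index t ord) ord.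

Definition insert_after (t : V) (l ord : seq V) : seq V :=
  take (index t ord).+1 ord ++ l ++ drop (index t ord).+1 ord.

Definition reorder (sort : {set V} -> seq V) (sr : search) (c : config) :
    config :=
  let ord := order c in
  let F := seen (fwd sr) in
  let B := seen (bwd sr) in
  let v := source sr in
  let t := [arg min_(x < v in v |: [set x in F | ~~ nilp (ptr (fwd sr) x)])
              index x ord] in
  let Flt := [set x in F | olt ord x t] in
  let Bgt := [set y in B | olt ord t y] in
  let ord' :=
    if t == v
    then insert_after t (sort Flt) [seq x <- ord | x \notin Flt]
    else insert_before t (sort Bgt ++ sort Flt)
           [seq x <- ord | (x \notin Flt) && (x \notin Bgt)] in
  let time := 1 + #|F| + #|B|
    + \sum_(x in Flt) (size (outs c x)).+1
    + \sum_(y in Bgt) (size (ins c y)).+1 in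
  Config ord' (outs c) (ins c) (todo c) None (cyclic c) (clock c + time).

Definition report_cycle (c : config) : config :=
  Config (order c) (outs c) (ins c) (todo c) None true (clock c).+1.

(* One iteration of the search loop up to the threshold updates; [None] means
   that a cycle is reported. *)
Definition search_step (u z : V) (sr : search) (c : config) : option search :=
  let s := threshold sr in
  let F := fwd sr in
  let B := bwd sr in
  if olt (order c) u z then
    let x := head u (ptr F u) in
    let y := head z (ptr B z) in
    (* The arcs are traversed one after the other: y is tested against a
       forward set that already contains x.  If the same new vertex x = y is
       reached from both sides, w ->* x ->* v, this is a cycle; letting x
       join both F and B would make the search run forever on the arcs
       (w,x), (x,v), (v,w) with initial order w < x < v. *)
    if (x \in seen B) || (y \in x |: seen F) then None else
    Some (Search (source sr)
            (discover (outs c) x (advance u F))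
            (discover (ins c) y (advance z B)) s)
  else
    Some (Search (source sr)
            (if olt (order c) s u then deactivate u F else F)
            (if olt (order c) z s then deactivate z B else B) s).

Definition with_search (c : config) (sr : search) (time : nat) : config :=
  Config (order c) (outs c) (ins c) (todo c) (Some sr) (cyclic c)
    (clock c + time).

Definition step (r : resolver) (tr : trace) : dist R config :=
  let c := tr.1 in
  if halted c then dret R c else
  match searching c, todo c with
  | None, [::] => dret R c
  | None, (v, w) :: arcs => dret R (add_arc (at_front r tr) v w arcs c)
  | Some sr, _ =>
    if (active (fwd sr) == set0) || (active (bwd sr) == set0)
    then dret R (reorder (static_sort r tr) sr c)
    else
      let: (u, z) := pick r tr in
      match search_step u z sr c with
      | None => dret R (report_cycle c)
      | Some sr' => dbind (refill_both (order c) sr')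
          (fun '(time, sr'') => dret R (with_search c sr'' time.+1))
      end
  end.

(* The distribution of the run after k steps. *)
Fixpoint run (r : resolver) (c0 : config) (k : nat) : dist R trace :=
  if k is k'.+1 then
    dbind (run r c0 k') (fun tr =>
    dbind (step r tr) (fun c => dret R (c, tr.1 :: tr.2)))
  else dret R (c0, [::]).

(* [T] is the expected total time of the runs from [c0]: after some number of
   steps all runs have halted, so that their clocks no longer change. *)
Definition expected_total_time (r : resolver) (c0 : config) (T : R) : Prop :=
  exists k : nat, surely (run r c0 k) (fun tr => halted tr.1) /\
    T = expectation (run r c0 k) (fun tr => (clock tr.1)%:R%R).

End SoftThresholdSearch.

(* Main.v *)
(* Call an ordered pair of arcs related if a path leads from the head of the
   first to the tail of the second; there are at most m ^ 2 such pairs.  If a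
   search traverses k pairs of arcs (u_i, x_i), (y_i, z_i) with u_i < z_i, then
   for all i, j one of u_i < z_j, u_j < z_i holds, so at least k ^ 2 / 2 of the
   pairs ((y_j, z_j), (u_i, x_i)) have u_i < z_j; these become related by the
   addition of the arc but were not so before.  By Cauchy-Schwarz (here in the
   form 2 k sqrt m <= k ^ 2 + m) at most O(m^(3/2)) arcs are traversed in all.

   It remains to charge the other iterations and the choices of thresholds to
   traversed arcs.  When the new threshold has rank j among k passive vertices,
   then at the next change of the threshold either the j vertices made active
   are exhausted or the k - j others and the threshold itself are given up.  As
   the expectation of min (j, k + 1 - j) is at least k / 4, a linear potential
   that anticipates this loss pays for everything, and the expected final clock
   is bounded by backward induction along the run. *)

Require Import Defs.
From HB Require Import structures.
From mathcomp Require Import all_boot all_order all_algebra.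
From mathcomp Require Import reals exp.
From mathcomp Require Import zify lra ring.

Set Implicit Arguments.
Unset Strict Implicit.
Unset Printing Implicit Defensive.

Import Order.TTheory GRing.Theory Num.Theory.

(** * Bounds on expectations over finitely supported distributions *)

Section Distributions.
Local Open Scope ring_scope.
Variable R : realType.

(** Includes the sign of the weights, on which the monotonicity of [expectation] rests. *)
Definition almost_surely {A : Type} (d : dist R A) (P : A -> Prop) : Prop :=
  foldr (fun p Q => (0 <= p.1 /\ P p.2) /\ Q) True d.

(** A Hoare triple for random computations: the weights form a probability distribution, [P] holds
    for the outcomes, and the budget [b] pays for [g] on average. *)
Definition spec {A : Type} (d : dist R A) (P : A -> Prop) (g : A -> R) (b : R) :
    Prop :=
  [/\ almost_surely d P, \sum_(p <- d) p.1 = 1 & expectation d g <= b].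

Lemma almost_surely_cat A (d1 d2 : dist R A) P :
  almost_surely d1 P -> almost_surely d2 P -> almost_surely (d1 ++ d2) P.
Proof. by elim: d1 => //= p d1 IH [? ?] ?; split; [|apply: IH]. Qed.

Lemma almost_surely_sub A (d : dist R A) (P Q : A -> Prop) :
  (forall a, P a -> Q a) -> almost_surely d P -> almost_surely d Q.
Proof.
by move=> PQ; elim: d => //= p d IH [[? ?] ?]; do !split => //; auto.
Qed.

Lemma almost_surely_bind A B (d : dist R A) (f : A -> dist R B) P Q :
  almost_surely d P -> (forall a, P a -> almost_surely (f a) Q) ->
  almost_surely (dbind d f) Q.
Proof.
move=> dP PQ; elim: d dP => //= p d IH [[p0 pP] dP].
apply: almost_surely_cat; last exact: IH.
elim: (f _) (PQ _ pP) => //= q e IHe [[q0 qQ] eQ].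
by do !split; rewrite ?mulr_ge0 //; apply: IHe.
Qed.

Lemma expectation_bind A B (d : dist R A) (f : A -> dist R B) X :
  expectation (dbind d f) X = expectation d (fun a => expectation (f a) X).
Proof.
rewrite /expectation /dbind big_flatten big_map; apply: eq_bigr => p _.
by rewrite big_map mulr_sumr; apply: eq_bigr => q _; rewrite mulrA.
Qed.

Lemma expectation_ret A (a : A) (X : A -> R) : expectation (dret R a) X = X a.
Proof. by rewrite /expectation /dret big_seq1 mul1r. Qed.

Lemma expectation1 A (d : dist R A) :
  \sum_(p <- d) p.1 = expectation d (fun=> 1).
Proof. by apply: eq_bigr => p _; rewrite mulr1. Qed.

Lemma expectation_le A (d : dist R A) (P : A -> Prop) (f g : A -> R) :
  almost_surely d P -> (forall a, P a -> f a <= g a) ->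
  expectation d f <= expectation d g.
Proof.
move=> dP fg; rewrite /expectation.
elim: d dP => [|p d IH] /=; first by rewrite !big_nil.
by move=> [[p0 pP] dP]; rewrite !big_cons lerD ?IH // ler_wpM2l ?fg.
Qed.

Lemma spec_ret A (a : A) (P : A -> Prop) (g : A -> R) b :
  P a -> g a <= b -> spec (dret R a) P g b.
Proof.
by move=> Pa ga; split; rewrite ?expectation_ret //= ?big_seq1 //; do !split.
Qed.

(** The law of total expectation: [g a] is the budget handed on to the computation that follows
    outcome [a]. *)
Lemma spec_bind A B (d : dist R A) (f : A -> dist R B) P g Q h b :
  spec d P g b -> (forall a, P a -> spec (f a) Q h (g a)) ->
  spec (dbind d f) Q h b.
Proof.
move=> [dP d1 dg] PQ; split.
- by apply: almost_surely_bind dP _ => a /PQ[].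
- rewrite expectation1 expectation_bind -[RHS]d1 [RHS]expectation1.
  apply/eqP; rewrite eq_le; apply/andP; split; apply: (expectation_le dP);
  by move=> a /PQ[_ + _]; rewrite expectation1 => ->.
- rewrite expectation_bind; apply: le_trans dg; apply: (expectation_le dP).
  by move=> a /PQ[].
Qed.

Lemma spec_weaken A (d : dist R A) (P Q : A -> Prop) g h b e :
  spec d P g b -> (forall a, P a -> Q a /\ h a <= g a + e) ->
  spec d Q h (b + e).
Proof.
move=> [dP d1 dg] PQ; split => //.
  by apply: almost_surely_sub dP => a /PQ[].
apply: (@le_trans _ _ (expectation d (fun a => g a + e))).
  by apply: (expectation_le dP) => a /PQ[].
rewrite /expectation; under eq_bigr do rewrite mulrDr.
by rewrite big_split /= -mulr_suml d1 mul1r lerD2r.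
Qed.

Lemma spec_bindD A B (d : dist R A) (f : A -> dist R B) P g Q h b e :
  spec d P g b -> (forall a, P a -> spec (f a) Q h (g a + e)) ->
  spec (dbind d f) Q h (b + e).
Proof.
move=> dP; apply: (spec_bind (g := fun a => g a + e)).
exact: spec_weaken dP (fun a Pa => conj Pa (lexx _)).
Qed.

(** The premise on the sum says, without division, that the mean of [g] over [S] is at most [b]. *)
Lemma spec_uniform (T : finType) (S : {set T}) (P : T -> Prop) (g : T -> nat) b :
  S != set0 -> {in S, forall x, P x} -> (\sum_(x in S) g x <= #|S| * b)%N ->
  spec (uniform R S) P (fun x => (g x)%:R) b%:R.
Proof.
rewrite -card_gt0 => S0 SP gb.
have S0R : 0 < #|S|%:R :> R by rewrite ltr0n.
split.
- have : {in enum S, forall x, P x} by move=> x; rewrite mem_enum; apply: SP.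
  rewrite /uniform; elim: (enum S) => //= x s IH sP; do !split.
  + by rewrite invr_ge0 ltW.
  + by apply: sP; rewrite inE eqxx.
  + by apply: IH => y ys; apply: sP; rewrite inE ys orbT.
- rewrite big_map big_enum /= sumr_const -[LHS]mulr_natl mulfV // gt_eqF //.
- rewrite /expectation /uniform big_map big_enum /= -mulr_sumr ler_pdivrMl //.
  by rewrite -natrM -natr_sum ler_nat.
Qed.

End Distributions.

(** * Ranks in a strict total order *)

Section StrictTotal.
Variable V : finType.

Definition strict_total (lt : rel V) : Prop :=
  [/\ irreflexive lt, transitive lt & forall x y, x != y -> lt x y || lt y x].

Lemma strict_total_flip (lt : rel V) :
  strict_total lt -> strict_total (fun x y => lt y x).
Proof.
move=> [irr tr tot]; split=> // [y x z xy yz | x y xy]; first exact: tr xy.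
by rewrite orbC tot.
Qed.

(** Induction in steps of two: taking off both extreme ranks removes two terms equal to 1 and lowers
    each of the others by one. The mean over the [k] ranks is thus at least k / 4. *)
Lemma sum_min_rank k : k * k <= 4 * \sum_(i < k) minn i.+1 (k - i).
Proof.
elim/ltn_ind: k => -[|[|k]] IH //; first by rewrite big_ord1.
rewrite big_ord_recl big_ord_recr /=.
have -> : \sum_(i < k) minn (bump 0 i).+1 (k.+2 - bump 0 i) =
          k + \sum_(i < k) minn i.+1 (k - i).
  rewrite -[X in X + _]card_ord -sum1_card -big_split /=.
  by apply: eq_bigr => i _; rewrite /bump /=; have := ltn_ord i; lia.
by have := IH k (ltnW (ltnSn _)); rewrite /bump /=; lia.
Qed.

(** The rank is strictly increasing, so it maps [P] injectively, and by cardinality bijectively, to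
    the numbers below [#|P|]. *)
Lemma sum_rank (lt : rel V) (P : {set V}) (g : nat -> nat) :
  strict_total lt ->
  \sum_(x in P) g #|[set y in P | lt y x]| = \sum_(i < #|P|) g i.
Proof.
move=> [irr tr tot].
have rank_lt x : x \in P -> #|[set y in P | lt y x]| < #|P|.
  move=> xP; apply: proper_card; apply/properP; split.
    by apply/subsetP => y; rewrite inE => /andP[].
  by exists x => //; rewrite inE irr andbF.
have rank_mono x y : x \in P -> lt x y ->
    #|[set z in P | lt z x]| < #|[set z in P | lt z y]|.
  move=> xP xy; apply: proper_card; apply/properP; split.
    by apply/subsetP => z; rewrite !inE => /andP[-> /tr -> //].
  by exists x; rewrite !inE ?irr ?andbF // xP.
case: (posnP #|P|) => [P0|Ppos].
  by rewrite P0 big_ord0 (cards0_eq P0) big_set0.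
(* On [P] ranks are below [#|P|], so [insubd] returns the rank and not the default. *)
pose rk (x : V) : 'I_#|P| := insubd (Ordinal Ppos) #|[set y in P | lt y x]|.
have rkE x : x \in P -> rk x = #|[set y in P | lt y x]| :> nat.
  by move=> xP; rewrite val_insubd rank_lt.
have rk_inj : {in P &, injective rk}.
  move=> x y xP yP /(congr1 val) /=; rewrite !rkE // => e.
  case: (eqVneq x y) => // /tot /orP[] /rank_mono.
    by move=> /(_ xP); rewrite e ltnn.
  by move=> /(_ yP); rewrite e ltnn.
transitivity (\sum_(i in [set rk x | x in P]) g i).
  by rewrite big_imset //=; apply: eq_bigr => x xP; rewrite rkE.
have -> : [set rk x | x in P] = setT.
  by apply/eqP; rewrite eqEcard subsetT cardsT card_ord card_in_imset /=.
by apply: eq_bigl => i; rewrite inE.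
Qed.

End StrictTotal.

(** * Invariants, potential and termination measure of the two sides of a search *)

Section Sides.
Variable V : finType.
Implicit Types (S own other : side V) (lt : rel V) (adj : V -> seq V).
Implicit Types (h : seq (V * V)).

Definition live S : {set V} := active S :|: passive S.

(** [h] lists the arcs traversed on this side, each starting at the vertex on whose list it stands.
    By [so_suffix] all neighbours of an exhausted vertex are seen; [so_card] and [so_sum] bound the
    size of what the reordering scans by [size h]. *)
Record side_ok adj (root : V) h S : Prop := SideOk {
  so_root : root \in seen S;
  so_live : forall x, x \in live S -> x \in seen S /\ ptr S x != [::];
  so_disj : forall x, x \in active S -> x \in passive S -> False;
  so_suffix : forall x, x \in seen S ->
    exists2 l, adj x = l ++ ptr S x & {subset l <= seen S};
  so_reach : forall x, x \in seen S -> connect (fun a b => b \in adj a) root x;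
  so_card : #|seen S| <= (size h).+1;
  so_sum : \sum_(x in seen S) size (adj x) =
           size h + \sum_(x in seen S) size (ptr S x);
  so_uniq : uniq h;
  so_hist : forall u x, (u, x) \in h ->
    [/\ u \in seen S, x \in adj u & x \notin ptr S u] }.

(* Vertices given up with arcs left are beyond everything still in play on the
   other side, and the threshold separates the two passive sets. *)
Definition separated lt own other (s : V) : Prop :=
  [/\ forall x z, x \in seen own -> ptr own x != [::] ->
        z \in seen other -> ptr other z != [::] ->
        (x \notin live own) || (z \notin live other) -> lt z x,
      forall x, x \in passive own -> lt s x &
      forall z, z \in passive other -> lt z s].

Lemma separated_flip lt own other s :
  separated lt own other s -> separated (fun x y => lt y x) other own s.
Proof.
move=> [h1 h2 h3]; split => // x z xs xp zs zp d.
by apply: h1 => //; rewrite orbC.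
Qed.

(* At least this many vertices of the side are going to be given up or
   exhausted before the threshold changes once more, whichever of the two sides
   runs out of active vertices first. *)
Definition quota lt S (s : V) : nat :=
  minn #|[set x in active S | ~~ lt s x]| (#|passive S| + (s \in active S)).

(* Making a vertex passive frees 3 units, which pay for the iteration.  A choice
   among k passive vertices costs at most k for scanning them and 3 k for making
   some of them active, against an expected gain of 16 (k / 4) in quota; the
   weight 17 of a vertex given up pays for its quota and for scanning it. *)
Definition weight lt S s : nat :=
  17 * #|passive S| + 20 * #|active S| - 16 * quota lt S s.

Definition potential lt own other s : nat :=
  weight lt own s + weight (fun x y => lt y x) other s.

(** Bounds the arcs this side may still traverse: an undiscovered vertex counts with its whole list,
    a vertex given up with nothing. *)
Definition work adj S : nat :=
  \sum_x if x \in seen S then (x \in live S) * size (ptr S x)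
         else size (adj x).

(** Lexicographic: first the work with one extra bit, then the number of active vertices. A refill
    that activates vertices either gives up an active threshold, which lowers the work, or replaces
    an inactive threshold by an active one, which clears the bit. The doubling lets any loss of work
    outweigh the bit being set. *)
Definition measure adj1 adj2 own other (s : V) : nat :=
  (2 * (work adj1 own + work adj2 other) +
     ~~ ((s \in active own) || (s \in active other))) * (2 * #|V|).+1 +
  (#|active own| + #|active other|).

Lemma potential_flip lt own other s :
  potential (fun x y => lt y x) own other s = potential lt other own s.
Proof. by rewrite /potential addnC. Qed.

Lemma lex_ltn x y n r r' : x < y -> r <= n -> x * n.+1 + r < y * n.+1 + r'.
Proof. nia. Qed.

Lemma quota_le lt S s : quota lt S s <= #|active S|.
Proof.
apply: leq_trans (geq_minl _ _) _; apply/subset_leq_card/subsetP => x.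
by rewrite inE => /andP[].
Qed.

Lemma side_ok_sub adj root h S S' :
  side_ok adj root h S -> seen S' = seen S -> ptr S' = ptr S ->
  live S' \subset live S ->
  (forall x, x \in active S' -> x \in passive S' -> False) ->
  side_ok adj root h S'.
Proof.
move=> [? sl ? ? ? ? ? ? ?] es ep /subsetP sub dis.
by split; rewrite ?es ?ep // => x /sub /sl.
Qed.

Lemma work_sub adj S S' :
  seen S' = seen S -> ptr S' = ptr S -> live S' \subset live S ->
  work adj S' <= work adj S.
Proof.
move=> es ep /subsetP sub; apply: leq_sum => x _; rewrite es ep.
case: ifP => // _; apply: leq_mul => //.
by case: (x \in live S') (sub x) => // /(_ isT) ->.
Qed.

Lemma work_lt adj root h S S' x :
  side_ok adj root h S ->
  seen S' = seen S -> ptr S' = ptr S -> live S' \subset live S ->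
  x \in live S -> x \notin live S' -> work adj S' < work adj S.
Proof.
move=> ok es ep sub xS xS'; have [xs xp] := so_live ok xS.
rewrite /work (bigD1 x) //= [X in _ < X](bigD1 x) //= es ep xs xS (negPf xS').
rewrite mul0n mul1n -add1n leq_add ?lt0n ?size_eq0 //.
apply: leq_sum => y _; case: ifP => // _; apply: leq_mul => //.
by case: (y \in live S') (subsetP sub y) => // /(_ isT) ->.
Qed.

Lemma start_side_ok adj x : side_ok adj x [::] (start_side adj x).
Proof.
have seenE y : (y \in seen (start_side adj x)) = (y == x) by rewrite inE.
have liveE y : (y \in live (start_side adj x)) -> y == x /\ ~~ nilp (adj x).
  by rewrite /live setU0 /=; case: (nilp _); rewrite !inE.
split=> //.
- by rewrite seenE.
- by move=> y /liveE[/eqP ->]; rewrite seenE /= eqxx; case: (adj x).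
- by move=> y _; rewrite inE.
- by move=> y; rewrite seenE => /eqP ->; exists [::]; rewrite //= eqxx.
- by move=> y; rewrite seenE => /eqP ->.
- by rewrite /= cards1.
- by rewrite /= !big_set1 eqxx.
Qed.

Lemma weight_start lt adj x s : weight lt (start_side adj x) s <= 20.
Proof.
rewrite /weight /= cards0 (leq_trans (leq_subr _ _)) // muln0 add0n.
by case: (nilp _); rewrite ?cards0 ?cards1.
Qed.

Lemma separated_start lt adj1 adj2 x y s :
  separated lt (start_side adj1 x) (start_side adj2 y) s.
Proof.
split=> [a b|a|a]; try by rewrite inE.
rewrite /live /= !setU0 !inE => /eqP -> + /eqP ->; rewrite !eqxx.
by case: (adj1 x) => //= ? ? _; case: (adj2 y) => //= ? ? _; rewrite !inE !eqxx.
Qed.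

Lemma leq_minn2 m1 m2 n1 n2 :
  m1 <= n1 -> m2 <= n2 -> minn m1 m2 <= minn n1 n2.
Proof. lia. Qed.

(** * Traversing one arc *)

Section Traverse.
Variables (adj : V -> seq V) (root : V) (h : seq (V * V)) (S : side V) (u x : V).
Variable rest : seq V.
Hypothesis ok : side_ok adj root h S.
Hypotheses (uA : u \in active S) (ptru : ptr S u = x :: rest).

Let S' := discover adj x (advance u S).
Let new y := (x \notin seen S) && (y == x).

Let useen : u \in seen S.
Proof. by case: (so_live ok (x := u)) => //; rewrite inE uA. Qed.

Let newF y : y \in seen S -> new y = false.
Proof.
by move=> ys; rewrite /new; case: eqVneq ys => [->|] ys; rewrite ?ys ?andbF.
Qed.

Lemma traverse_seen : seen S' = x |: seen S.
Proof.
rewrite /S' /discover; case: ifP => //= xs; apply/setP => y; rewrite !inE.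
by case: eqVneq => // ->.
Qed.

Lemma traverse_passive : passive S' = passive S.
Proof. by rewrite /S' /discover; case: ifP. Qed.

Lemma traverse_ptr y :
  ptr S' y = if new y then adj x else if y == u then rest else ptr S y.
Proof. by rewrite /S' /discover /new; case: ifP => /= _; rewrite ptru. Qed.

Lemma traverse_active y :
  (y \in active S') = new y && ~~ nilp (adj x) ||
                      (y \in active S) && ~~ ((y == u) && nilp rest).
Proof.
rewrite /S' /discover /new; case: ifP => /= _; rewrite ptru /=.
  by case: (nilp rest); rewrite ?inE ?andbF ?andbT //= andbC.
case: (nilp rest); case: (nilp (adj x)); rewrite ?inE ?andbF ?andbT //=.
- by rewrite andbC.
- by congr (_ || _); rewrite andbC.
Qed.

Lemma traverse_live y :
  (y \in live S') = new y && ~~ nilp (adj x) ||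
                      (y \in live S) && ~~ ((y == u) && nilp rest).
Proof.
rewrite !inE traverse_active traverse_passive -orbA; congr (_ || _).
case: eqVneq => [->|] /=; last by rewrite !andbT.
case: (boolP (u \in passive S)) => [/(so_disj ok uA)//|_]; by rewrite !orbF.
Qed.

Lemma traverse_arc : x \in adj u.
Proof.
by have [l -> _] := so_suffix ok useen; rewrite ptru mem_cat inE eqxx orbT.
Qed.

Lemma traverse_ok : uniq (adj u) -> side_ok adj root ((u, x) :: h) S'.
Proof.
move=> adj_uniq.
have [l lE lsub] := so_suffix ok useen; rewrite ptru in lE.
have seen'E := traverse_seen.
(* As the list has no repetition, the recorded arc has really left the part still to be traversed,
   as [so_hist] demands. *)
have xrest : x \notin rest.
  by move: adj_uniq; rewrite lE cat_uniq /= => /and3P[_ _ /andP[]].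
split.
- by rewrite seen'E inE (so_root ok) orbT.
- move=> y; rewrite traverse_live seen'E traverse_ptr !inE => /orP[].
    move=> /andP[ny]; rewrite ny; case/andP: ny => _ -> /=.
    by case: (adj x).
  move=> /andP[yl nu]; have [ys yp] : y \in seen S /\ ptr S y != [::].
    by apply: (so_live ok); rewrite inE.
  rewrite newF // ys orbT; split=> //.
  by case: eqVneq nu => //= _; case: rest.
- move=> y; rewrite traverse_active traverse_passive => /orP[].
    move=> /andP[/andP[xs /eqP ->] _] xp; case/negP: xs.
    by case: (so_live ok (x := x)) => //; rewrite inE xp orbT.
  by case/andP => ya _; exact: (so_disj ok ya).
- move=> y; rewrite seen'E inE traverse_ptr in_set1.
  case: (boolP (new y)) => [/andP[_ /eqP ->] _|ny ys].
    by exists [::].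
  have {}ys : y \in seen S.
    case/orP: ys => // /eqP yx; move: ny.
    by rewrite /new yx eqxx andbT negbK.
  case: eqVneq => [->|_].
    exists (rcons l x); first by rewrite cat_rcons.
    by move=> z; rewrite mem_rcons !inE => /orP[->//|/lsub ->]; rewrite orbT.
  have [l' -> l'sub] := so_suffix ok ys; exists l' => // z /l'sub.
  by rewrite inE orbC => ->.
- move=> y; rewrite seen'E !inE => /orP[/eqP ->|]; last exact: (so_reach ok).
  apply: (connect_trans (so_reach ok useen)); apply: connect1.
  exact: traverse_arc.
- rewrite seen'E cardsU1 /=; have := so_card ok.
  by case: (x \in seen S) => /=; lia.
- rewrite seen'E /= addSnnS.
  have ptrE : \sum_(y in seen S) size (ptr S y) =
      (\sum_(y in seen S) size (ptr S' y)).+1.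
    rewrite (bigD1 u) //= [in RHS](bigD1 u) //= ptru traverse_ptr newF //.
    rewrite eqxx /= addSn; congr (_ + _).+1; apply: eq_bigr => y /andP[ys yu].
    by rewrite traverse_ptr newF // (negPf yu).
  case: (boolP (x \in seen S)) => xs.
    have -> : x |: seen S = seen S by apply/setUidPr; rewrite sub1set.
    by rewrite (so_sum ok) ptrE.
  rewrite !big_setU1 //= traverse_ptr /new xs eqxx /= (so_sum ok) ptrE; lia.
- rewrite /= (so_uniq ok) andbT; apply/negP => /(so_hist ok)[_ _].
  by rewrite ptru inE eqxx.
- move=> a b; rewrite inE => /orP[/eqP[-> ->]|/(so_hist ok)[aS ab abp]].
    by rewrite seen'E inE useen orbT traverse_arc traverse_ptr newF // eqxx.
  rewrite seen'E inE aS orbT ab traverse_ptr newF //; split=> //.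
  case: eqVneq => // au; move: abp.
  by rewrite au ptru inE negb_or => /andP[].
Qed.

(** The list of [u] gets shorter, and discovering [x] adds nothing because its whole list was
    counted before. *)
Lemma traverse_work : work adj S' < work adj S.
Proof.
rewrite /work (bigD1 u) //= [X in _ < X](bigD1 u) //= -addSn leq_add //.
  rewrite traverse_seen traverse_live traverse_ptr newF // eqxx !inE useen orbT.
  by rewrite uA ptru /=; case: rest => //= a r; rewrite !mul1n.
apply: leq_sum => y yu; rewrite traverse_seen traverse_live traverse_ptr.
rewrite !inE (negPf yu) andbT.
case: (boolP (new y)) => [ny|nny] /=.
  case/andP: (ny) => /negPf xs /eqP ->; rewrite eqxx xs /=.
  by case: (_ || _); rewrite ?mul1n.
case: (boolP (y \in seen S)) => ys; first by rewrite orbT.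
rewrite orbF; case: eqVneq => // yx; move: nny.
by rewrite /new -yx ys eqxx.
Qed.

(** Exhausting [u] saves 20 and lowers the quota by at most one, which costs 16; a discovered vertex
    adds at most 20 and cannot lower the quota. *)
Lemma traverse_weight lt s : weight lt S' s <= weight lt S s + 20.
Proof.
have step1 : weight lt (advance u S) s <= weight lt S s.
  rewrite /weight /quota /= ptru /=; case: (nilp rest) => //.
  have := quota_le lt S s; rewrite /quota.
  have := subset_leq_card (subsetIl (active S) [set u]).
  have -> : #|active S| = #|active S :\ u|.+1 by rewrite (cardsD1 u) uA.
  have : (s \in active S) <= (s \in active S :\ u) + 1.
    by rewrite !inE; case: (s == u); case: (s \in _).
  have : #|[set y in active S | ~~ lt s y]| <=
      #|[set y in active S :\ u | ~~ lt s y]| + 1.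
    rewrite (cardsD1 u) addnC leq_add //; last by case: (u \in _).
    by apply/subset_leq_card/subsetP => y; rewrite !inE andbA.
  lia.
rewrite /S' /discover; case: ifP => [|xs]; first by lia.
apply: leq_trans (leq_add step1 (leqnn _)).
case: (nilp (adj x)); first by rewrite /weight /quota /=; lia.
set T := advance u S; rewrite /weight /=.
have : quota lt T s <= quota lt (Side (x |: seen S) (x |: active T) (passive T)
    [eta ptr T with x |-> adj x]) s.
  rewrite /quota /=; apply: leq_minn2.
    apply/subset_leq_card/subsetP => y; rewrite !inE => /andP[-> ->].
    by rewrite orbT.
  by rewrite leq_add2l inE; case: (s \in active T); rewrite ?orbT.
have := quota_le lt T s.
have : #|x |: active T| <= #|active T| + 1.
  by rewrite cardsU1 addnC leq_add2l; case: (_ \notin _).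
rewrite /T /=; lia.
Qed.

(** Since [u] still has arcs, any vertex given up on the other side with arcs left is before [u],
    hence before the new vertex [x]. *)
Lemma traverse_separated lt other s :
  transitive lt -> lt u x -> separated lt S other s -> separated lt S' other s.
Proof.
move=> tr ux [h1 h2 h3]; split=> //; last by rewrite traverse_passive.
move=> y z; rewrite traverse_seen traverse_live traverse_ptr.
case: (boolP (new y)) => [/andP[xs /eqP ->]|ny] /=.
  move=> _ adjx zs zp; have -> : ~~ nilp (adj x) by case: (adj x) adjx.
  move=> zl; apply: tr ux; apply: h1 => //; first by rewrite ptru.
  by rewrite [z \notin _]zl orbT.
rewrite in_setU1 => ys; have {}ys : y \in seen S.
  case/orP: ys => // /eqP yx; move: ny; rewrite /new yx eqxx andbT negbK //.
case: (eqVneq y u) => [->|yu] yp zs zp; last by rewrite andbT => d; apply: h1.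
have -> : ~~ nilp rest by case: rest yp.
by rewrite andbT => d; apply: h1; rewrite ?ptru.
Qed.

End Traverse.

(** * Making a vertex passive *)

Section Deactivate.
Variables (lt : rel V) (S : side V) (u s : V).
Hypotheses (irr : irreflexive lt) (uA : u \in active S) (su : lt s u).

Let S' := deactivate u S.

Lemma deactivate_live : live S' = live S.
Proof.
apply/setP => y; rewrite !inE; case: eqVneq => [->|] //=.
by rewrite uA.
Qed.

Lemma deactivate_ok adj root h : side_ok adj root h S -> side_ok adj root h S'.
Proof.
move=> ok; apply: (side_ok_sub ok); rewrite ?deactivate_live //.
move=> y /setD1P[/negPf yu ya] /setU1P[/eqP|]; rewrite ?yu //.
exact: (so_disj ok ya).
Qed.

Lemma deactivate_mem : (s \in active S') = (s \in active S).
Proof. by rewrite !inE; case: eqVneq su => //= ->; rewrite irr. Qed.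

Lemma deactivate_card : #|active S'| < #|active S|.
Proof. by rewrite [X in _ < X](cardsD1 u) uA. Qed.

(** The weight of [u] drops from 20 to 17 and the quota does not fall: [u] is beyond [s], so the
    first term of the minimum does not count it, and the second term can only grow. *)
Lemma deactivate_weight : weight lt S' s + 3 <= weight lt S s.
Proof.
rewrite /weight; have := quota_le lt S s.
have : quota lt S s <= quota lt S' s.
  rewrite /quota deactivate_mem; apply: leq_minn2; last first.
    by rewrite leq_add2r; apply/subset_leq_card/subsetUr.
  apply/subset_leq_card/subsetP => y; rewrite !inE => /andP[-> sy].
  by rewrite sy !andbT; apply: contraNneq sy => ->.
have := quota_le lt S' s.
have : #|passive S'| <= #|passive S| + 1.
  by rewrite cardsU1 addnC leq_add2l; case: (_ \notin _).
have : #|active S| = #|active S'|.+1 by rewrite (cardsD1 u) uA.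
lia.
Qed.

Lemma deactivate_separated other :
  separated lt S other s -> separated lt S' other s.
Proof.
move=> [h1 h2 h3]; split; rewrite ?deactivate_live //.
by move=> y /setU1P[->|/h2].
Qed.

End Deactivate.

(** * Choosing a new threshold *)

Section Refill.
Variable R : realType.

(** The expected time plus potential rises by at most one. The order is arbitrary so that both
    directions are covered. *)
Lemma spec_refill (le lt : rel V) own other s adj1 adj2 r1 r2 h1 h2 :
  strict_total lt -> (forall x y, le x y = ~~ lt y x) ->
  side_ok adj1 r1 h1 own -> side_ok adj2 r2 h2 other ->
  separated lt own other s ->
  spec (refill R le own other s)
    (fun p => let: (t, own', other', s') := p in
      [/\ [/\ side_ok adj1 r1 h1 own', side_ok adj2 r2 h2 other' &
              separated lt own' other' s'],
          [/\ seen own' = seen own, seen other' = seen other,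
              ptr own' = ptr own & ptr other' = ptr other],
          active own' = set0 -> passive own' = set0,
          ((active other = set0 -> passive other = set0) ->
           active other' = set0 -> passive other' = set0) &
          measure adj1 adj2 own' other' s' <= measure adj1 adj2 own other s])
    (fun p => let: (t, own', other', s') := p in
      (t + potential lt own' other' s')%:R%R)
    (1 + potential lt own other s)%:R%R.
Proof.
move=> st leE ok1 ok2 [sep1 sep2 sep3]; have [irr tr tot] := st.
rewrite /refill; case: ifP => [act|/negbFE/eqP act].
  apply: spec_ret; last by rewrite ler_nat add0n add1n.
  by split=> // e; rewrite e eqxx in act.
set other' := Side _ _ _ _.
have sub2 : live other' \subset live other.
  rewrite /live /other' /= setU0; apply: subset_trans (subD1set _ _) _.
  exact: subsetUl.
have ok2' : side_ok adj2 r2 h2 other'.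
  by apply: (side_ok_sub ok2) => // x _; rewrite inE.
have dead2 z : z \in live other -> z \notin live other' ->
    (z = s) \/ (z \in passive other).
  rewrite /live /other' /= setU0 !inE => /orP[->|->]; last by right.
  by rewrite andbT negbK => /eqP; left.
(* A vertex just given up on the other side is [s] or was passive there, so it is not after [s],
   while the live vertices of [own] are all passive and thus after [s]. *)
have sep1' own' : seen own' = seen own -> ptr own' = ptr own ->
    (forall x, x \in live own -> x \in live own') ->
    forall x z, x \in seen own' -> ptr own' x != [::] ->
        z \in seen other' -> ptr other' z != [::] ->
        (x \notin live own') || (z \notin live other') -> lt z x.
  move=> -> -> sub x z xs xp zs zp d.
  case: (boolP ((x \notin live own) || (z \notin live other))).
    exact: sep1.
  rewrite negb_or !negbK => /andP[xl zl].
  move: d; rewrite (sub _ xl) /= => zd.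
  have sx : lt s x.
    by apply: sep2; move: xl; rewrite /live act set0U.
  by case: (dead2 _ zl zd) => [->//|/sep3 zs']; apply: tr zs' sx.
have card2 : #|active other| = (s \in active other) + #|active other :\ s|.
  by rewrite (cardsD1 s).
(* The quota hides at most 16 of the 17 units of a passive vertex that is given up; the last unit
   pays for scanning it. *)
have w2 : 17 * #|passive other| + 20 * #|active other| <=
    weight (fun x y => lt y x) other s +
    16 * (#|passive other| + (s \in active other)).
  rewrite /weight /quota; lia.
have w2' s' : weight (fun x y => lt y x) other' s' <= 20 * #|active other :\ s|.
  by rewrite /weight /= cards0 muln0 add0n leq_subr.
have w1 : weight lt own s = 17 * #|passive own|.
  rewrite /weight /quota act cards0 inE.
  have -> : #|[set x in set0 | ~~ lt s x]| = 0.
    by apply/eqP; rewrite cards_eq0; apply/eqP/setP => x; rewrite !inE.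
  by rewrite min0n; lia.
have work2 : work adj2 other' + (s \in active other) <= work adj2 other.
  case: (boolP (s \in active other)) => sa.
    rewrite addn1; apply: (work_lt (x := s) ok2) => //.
      by rewrite inE sa.
    by rewrite /live /other' /= setU0 !inE eqxx.
  by rewrite addn0; apply: work_sub.
have s_own : s \notin active own by rewrite act inE.
have Vle (A : {set V}) : #|A| <= #|V| by apply: max_card.
case: ifP => [/eqP pas|/negbT pas].
  apply: spec_ret.
    split=> //.
    - split=> //; split=> //; first exact: sep1'.
      by move=> z; rewrite inE.
    - rewrite /measure act cards0 !inE eqxx /=.
      have : #|active other :\ s| <= #|V| by [].
      move: work2 card2; case: (s \in active other) => /=; nia.
  rewrite ler_nat /potential w1 pas cards0.
  have := w2' s; have := w2; rewrite card2.
  lia.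
set k := #|passive own| in w1 *.
pose side' s' := Side (seen own) [set x in passive own | le x s']
  [set x in passive own | ~~ le x s'] (ptr own).
have sE x s' : x \in passive own -> (x \in active (side' s')) = ~~ lt s' x.
  by move=> xp; rewrite inE xp leE.
have live1 s' : live (side' s') = passive own.
  by apply/setP => x; rewrite !inE -andb_orr orbN andbT.
have ok1' s' : side_ok adj1 r1 h1 (side' s').
  apply: (side_ok_sub ok1) => // [|x]; first by rewrite live1 subsetUr.
  by rewrite !inE => /andP[_ ->] /andP[].
have card1 s' : #|active (side' s')| + #|passive (side' s')| = k.
  rewrite -cardsUI -/(live _) live1 -/k -[RHS]addn0; apply/eqP.
  rewrite eqn_add2l cards_eq0 -subset0; apply/subsetP => x; rewrite !inE.
  by case: (le x s'); rewrite ?andbF.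
have rank s' : s' \in passive own ->
    #|active (side' s')| = #|[set y in passive own | lt y s']|.+1.
  move=> s'P; rewrite (cardsD1 s') sE // irr add1n; congr _.+1.
  apply: eq_card => y; rewrite !inE leE andbCA; congr (_ && _).
  case: eqVneq => [->|ys] /=; first by rewrite irr.
  case/orP: (tot _ _ ys) => h; rewrite h ?andbT.
    by apply/negP => /(tr _ _ _ h); rewrite irr.
  by symmetry; apply/negbTE/negP => /(tr _ _ _ h); rewrite irr.
(* Here [i] is the rank counted from 0: [i + 1] vertices become active, and [k - i - 1] stay
   passive, to which the quota adds the active threshold itself. *)
have weight1 s' : s' \in passive own ->
    let i := #|[set y in passive own | lt y s']| in
    weight lt (side' s') s' + 16 * minn i.+1 (k - i) <= 17 * k + 3 * k /\ i < k.
  move=> s'P i; have := card1 s'; rewrite rank // -/i => ck.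
  split; last lia.
  rewrite /weight /quota rank // -/i sE // irr /=.
  have -> : [set x in active (side' s') | ~~ lt s' x] = active (side' s').
    by apply/setP => x; rewrite !inE leE -andbA andbb.
  by rewrite rank // -/i; rewrite /= in ck; lia.
apply: (spec_bind (g := fun s' =>
    (1 + k + #|passive other| + potential lt (side' s') other' s')%:R%R)
    (P := fun s' => s' \in passive own)).
  apply: spec_uniform => //.
  have srk := sum_rank (passive own) (fun i => minn i.+1 (k - i)) st.
  have smk := sum_min_rank k; rewrite -srk in smk.
  set m := \sum_(x in passive own) _ in smk.
  rewrite -(leq_add2r (16 * m)) /m big_distrr -big_split /=.
  (* The 21 units per passive vertex are 1 for the scan and 17 + 3 for the weight before subtracting
     the quota; the quotas sum to [m], and 16 times [m] is at least [4 * (k * k)], which brings 21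
     down to 17. *)
  apply: (@leq_trans (\sum_(x in passive own)
    (1 + 21 * k + #|passive other| + 20 * #|active other :\ s|))).
    apply: leq_sum => x xP; have [] := weight1 _ xP; have := w2' x.
    rewrite /potential; lia.
  rewrite sum_nat_const -/k -big_distrr /= -/m.
  have : potential lt own other s >= 17 * k + #|passive other| +
    20 * #|active other :\ s| by rewrite /potential w1; lia.
  have : 4 * (k * k) <= 16 * m by lia.
  nia.
move=> s' s'P; apply: spec_ret => //.
have s's : lt s s' by apply: sep2.
split=> //.
- split; [exact: ok1'|exact: ok2'|split].
  + by apply: sep1' => // x; rewrite live1 /live act set0U.
  + by move=> x; rewrite !inE leE negbK => /andP[].
  + by move=> z; rewrite inE.
- by move=> /setP/(_ s'); rewrite -/(side' s') sE // irr inE.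
(* The new threshold is active, so the bit is now 0: either it was 1 before or the work has
   dropped. *)
- have s'a : s' \in active (side' s') by rewrite sE // irr.
  have : #|[set x in passive own | le x s']| <= #|V| by [].
  have : #|active other :\ s| <= #|V| by [].
  have : work adj1 (side' s') <= work adj1 own.
    by apply: work_sub; rewrite // live1 subsetUr.
  rewrite -/(side' s'); move: work2 card2.
  rewrite /measure s'a act cards0 in_set0 /=.
  by case: (s \in active other) => /= *; apply/ltnW/lex_ltn; lia.
Qed.

End Refill.

End Sides.

(** * Moving a block of vertices within an ordered list *)

Section Orders.
Variable V : finType.
Implicit Types (ord : seq V) (e : rel V) (t v w x y : V).

Lemma perm_mem_enum ord x : perm_eq ord (enum V) -> x \in ord.
Proof. by move=> /perm_mem ->; rewrite mem_enum. Qed.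

Lemma olt_strict_total ord : perm_eq ord (enum V) -> strict_total (olt ord).
Proof.
move=> po; split=> [x|y x z|x y xy]; rewrite /olt ?ltnn //; first exact: ltn_trans.
rewrite -neq_ltn; apply: contraNneq xy => xy; apply/eqP.
by apply: (index_inj x) xy; apply: perm_mem_enum.
Qed.

Lemma topological_ole ord e x y :
  (forall a b, e a b -> olt ord a b) -> connect e x y -> ole ord x y.
Proof.
move=> eo /connectP[p pp ->].
elim: p x pp => [|b p IH] x /=; first by rewrite /ole.
by move=> /andP[/eo xb /IH]; apply: leq_trans; apply: ltnW.
Qed.

Lemma olt_filter (p : pred V) ord x y :
  p x -> p y -> olt (filter p ord) x y = olt ord x y.
Proof.
rewrite /olt => px py; elim: ord => //= a ord IH.
case: (boolP (p a)) => pa /=; first by do 2![case: ifP => // _]; rewrite !ltnS.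
have ne z : p z -> (a == z) = false by apply: contraTF => /eqP <-.
by rewrite !ne // !ltnS.
Qed.

Section Insert.
Variables (ord blk : seq V) (i : nat).
Hypotheses (po : perm_eq ord (enum V)) (ub : uniq blk).
Let L := [seq x <- ord | x \notin blk].
(** Common form of [insert_before] and [insert_after]: the block is taken out and put back at
    position [i] of the rest. *)
Let ord' := take i L ++ blk ++ drop i L.

Lemma mem_rest x : (x \in L) = (x \notin blk).
Proof. by rewrite mem_filter (perm_mem_enum x po) andbT. Qed.

Lemma perm_insert : perm_eq ord' (enum V).
Proof.
have : perm_eq ord' (blk ++ L) by rewrite /ord' perm_catCA cat_take_drop.
move=> /perm_trans; apply; apply: uniq_perm; rewrite ?enum_uniq //.
  rewrite cat_uniq ub filter_uniq ?(perm_uniq po) ?enum_uniq // andbT /=.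
  by apply/hasPn => x; rewrite mem_rest.
by move=> x; rewrite mem_cat mem_rest mem_enum orbN.
Qed.

Lemma olt_insert_rest x y :
  x \notin blk -> y \notin blk -> olt ord' x y = olt ord x y.
Proof.
move=> xb yb; rewrite -(@olt_filter [pred z | z \notin blk] ord) //.
rewrite -(@olt_filter [pred z | z \notin blk] ord') //; congr (olt _ x y).
rewrite /ord' !filter_cat.
have -> : [seq z <- blk | [pred z | z \notin blk] z] = [::].
  by apply/eqP; rewrite -(negbK (_ == _)) -has_filter; apply/hasPn => z /= ->.
rewrite cat0s -filter_cat cat_take_drop; apply/all_filterP/allP => z.
by rewrite mem_filter => /andP[].
Qed.

Lemma olt_insert_block x y : x \in blk -> y \in blk -> olt ord' x y = olt blk x y.
Proof.
move=> xb yb; rewrite -(@olt_filter (mem blk) ord') //; congr (olt _ x y).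
rewrite /ord' !filter_cat.
have drop_blk s : {subset s <= L} -> [seq z <- s | mem blk z] = [::].
  move=> sL; apply/eqP; rewrite -(negbK (_ == _)) -has_filter.
  by apply/hasPn => z /sL; rewrite mem_rest.
rewrite (drop_blk (take i L)) => [|z /mem_take //].
rewrite (drop_blk (drop i L)) => [|z /mem_drop //].
by rewrite cats0; apply/all_filterP/allP.
Qed.

Lemma olt_insert_before x y :
  x \notin blk -> index x L < i -> y \in blk -> olt ord' x y.
Proof.
move=> xb xi yb; rewrite /olt /ord' !index_cat in_take ?mem_rest // xi.
have /negPf -> : y \notin take i L.
  by apply/negP => /mem_take; rewrite mem_rest yb.
apply: (@leq_trans (size (take i L))); rewrite ?leq_addr //.
by rewrite index_mem in_take ?mem_rest.
Qed.

Lemma olt_insert_after x y :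
  x \in blk -> y \notin blk -> i <= index y L -> olt ord' x y.
Proof.
move=> xb yb iy; rewrite /olt /ord' !index_cat.
have /negPf -> : x \notin take i L.
  by apply/negP => /mem_take; rewrite mem_rest xb.
rewrite in_take ?mem_rest // [_ < i]ltnNge iy xb (negPf yb) /= ltn_add2l.
by apply: (@leq_trans (size blk)); rewrite ?index_mem ?leq_addr.
Qed.

End Insert.

(** Provides the witness required before the static sort can be relied upon. *)
Lemma topological_filter ord e (S : {set V}) :
  perm_eq ord (enum V) -> {in S &, forall x y, e x y -> olt ord x y} ->
  topological e S [seq x <- ord | x \in S].
Proof.
move=> po eo; split.
  apply: uniq_perm; rewrite ?enum_uniq ?filter_uniq ?(perm_uniq po) ?enum_uniq //.
  by move=> x; rewrite mem_filter (perm_mem_enum x po) mem_enum andbT.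
move=> x y xS yS /(eo _ _ xS yS).
by rewrite (@olt_filter [pred x | x \in S]).
Qed.

End Orders.

(** * Counting related pairs of arcs *)

Section Counting.
Variable V : finType.
Implicit Types (ord : seq V) (e : rel V) (v w : V).

Definition related (e : rel V) : {set (V * V) * (V * V)} :=
  [set p | [&& e p.1.1 p.1.2, e p.2.1 p.2.2 & connect e p.1.2 p.2.1]].

(* The pairs of arcs that become related when (v, w) is added and are ordered
   as those traversed together by a search. *)
Definition newly_related (e : rel V) ord v w : {set (V * V) * (V * V)} :=
  [set p | [&& e p.1.1 p.1.2, e p.2.1 p.2.2, connect e p.1.2 v,
               connect e w p.2.1 & olt ord p.2.1 p.1.2]].

Lemma card_related e (A : seq (V * V)) :
  (forall x y, e x y -> (x, y) \in A) -> #|related e| <= size A * size A.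
Proof.
move=> eA; have cA : #|[set x in A]| <= size A by rewrite cardsE card_size.
apply: leq_trans (leq_mul cA cA); rewrite -cardsX; apply/subset_leq_card.
by apply/subsetP => -[[a b] [c d]]; rewrite !inE /= => /and3P[/eA -> /eA ->].
Qed.

(** The two sets are disjoint, since in a topological order a path from head to tail forbids the
    tail to precede the head; pairs of the second kind are joined by a path through the new arc. *)
Lemma card_newly_related (e e' : rel V) ord v w :
  (forall x y, e x y -> e' x y) -> e' v w ->
  (forall x y, e x y -> olt ord x y) ->
  #|related e| + #|newly_related e' ord v w| <= #|related e'|.
Proof.
move=> ee' vw eo; rewrite -cardsUI.
have -> : related e :&: newly_related e' ord v w = set0.
  apply/setP => -[[a b] [c d]]; rewrite !inE /=; apply/negP.
  move=> /andP[/and3P[_ _ /(topological_ole eo) bc] /and5P[_ _ _ _]].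
  by rewrite /olt ltnNge [_ <= _]bc.
rewrite cards0 addn0; apply/subset_leq_card/subsetP => -[[a b] [c d]].
rewrite !inE /= => /orP[/and3P[/ee' -> /ee' -> bc]|/and5P[-> -> bv wc _]] /=.
  by apply: (connect_sub _ bc) => x y /ee'/connect1.
exact: connect_trans (connect_trans bv (connect1 vw)) wc.
Qed.

(** For entries p, q of [hh], one of u_p < z_q and u_q < z_p holds; otherwise z_q <= u_p < z_p <=
    u_q < z_q. *)
Lemma pairs_newly_related e ord v w (hh : seq ((V * V) * (V * V))) :
  uniq (unzip1 hh) -> uniq (unzip2 hh) ->
  (forall u x, (u, x) \in unzip1 hh -> e u x /\ connect e w u) ->
  (forall z y, (z, y) \in unzip2 hh -> e y z /\ connect e z v) ->
  all (fun p => olt ord p.1.1 p.2.1) hh ->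
  size hh * size hh <= 2 * #|newly_related e ord v w|.
Proof.
move=> u1 u2 h1 h2 hlt.
(* Backward arcs are stored reversed; [f] turns them round and puts them first, as the earlier arc
   of a related pair. *)
pose f (a b : V * V) := ((b.2, b.1), a).
pose s := [seq r <- [seq f a b | a <- unzip1 hh, b <- unzip2 hh] |
           olt ord r.2.1 r.1.2].
have us : uniq s.
  rewrite filter_uniq // allpairs_uniq // => -[a [b1 b2]] [c [d1 d2]] _ _ /=.
  by case=> -> -> ->.
have sN : size s <= #|newly_related e ord v w|.
  rewrite -(card_uniqP us); apply/subset_leq_card/subsetP => r.
  rewrite mem_filter => /andP[lt /allpairsP[[[a1 a2] [b1 b2]] /= [aH bH re]]].
  move: lt; rewrite re !inE /= => ->.
  by have [-> ->] := h1 _ _ aH; have [-> ->] := h2 _ _ bH.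
apply: leq_trans (leq_mul (leqnn 2) sN).
have -> : size s = \sum_(p <- hh) \sum_(q <- hh) olt ord p.1.1 q.2.1.
  rewrite size_filter -sum1_count big_mkcond big_allpairs_dep /=.
  rewrite /unzip1 /unzip2 big_map; apply: eq_bigr => p _; rewrite big_map.
  by apply: eq_bigr => q _ /=; case: olt.
(* Adding the double sum to its transpose makes the term of each (p, q) at least 1. *)
rewrite mul2n -addnn [X in _ <= _ + X]exchange_big -big_split /=.
rewrite -[X in X * _]sum1_size big_distrl /= big_seq [X in _ <= X]big_seq.
apply: leq_sum => p pH; rewrite mul1n -big_split /= -sum1_size.
rewrite big_seq [X in _ <= X]big_seq; apply: leq_sum => q qH.
move: (allP hlt _ pH) (allP hlt _ qH); rewrite /olt; lia.
Qed.

End Counting.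

Local Notation order := Defs.order.

(** * Invariant of a search *)

Section SearchSteps.
Variable V : finType.
Implicit Types (c : config V) (sr : search V) (hh : seq ((V * V) * (V * V))).

(* [hh] lists the pairs of arcs traversed so far, (u, x) being stored as itself
   and (y, z) as (z, y), so that each arc starts where its list hangs. *)
Record search_ok c (w : V) hh sr : Prop := SearchOk {
  ss_perm : perm_eq (order c) (enum V);
  ss_ins : forall x y, (x \in ins c y) = (y \in outs c x);
  ss_uouts : forall x, uniq (outs c x);
  ss_uins : forall x, uniq (ins c x);
  ss_back : olt (order c) w (source sr);
  ss_order : forall x y, edge c x y -> (x, y) <> (source sr, w) ->
    olt (order c) x y;
  ss_fwd : side_ok (outs c) w (unzip1 hh) (fwd sr);
  ss_bwd : side_ok (ins c) (source sr) (unzip2 hh) (bwd sr);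
  ss_disj : forall x, x \in seen (fwd sr) -> x \notin seen (bwd sr);
  ss_pairs : all (fun p => olt (order c) p.1.1 p.2.1) hh;
  ss_sep : separated (olt (order c)) (fwd sr) (bwd sr) (threshold sr) }.

(** Restored after each threshold update: a side that ends the loop by having no active vertex has
    no live vertex at all. *)
Definition settled sr : Prop :=
  (active (fwd sr) = set0 -> passive (fwd sr) = set0) /\
  (active (bwd sr) = set0 -> passive (bwd sr) = set0).

Definition search_potential c sr : nat :=
  potential (olt (order c)) (fwd sr) (bwd sr) (threshold sr).

Definition search_measure c sr : nat :=
  measure (outs c) (ins c) (fwd sr) (bwd sr) (threshold sr).

(** The only arc against the order leaves [source sr], which is seen on the backward side and so not
    on the forward one. *)
Lemma search_ok_lt_fwd c w hh sr u x : search_ok c w hh sr ->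
  u \in seen (fwd sr) -> x \in outs c u -> olt (order c) u x.
Proof.
move=> ok us ux; apply: (ss_order ok) => // -[uv _].
by move: (ss_disj ok us); rewrite uv (so_root (ss_bwd ok)).
Qed.

Lemma search_ok_lt_bwd c w hh sr z y : search_ok c w hh sr ->
  z \in seen (bwd sr) -> y \in ins c z -> olt (order c) y z.
Proof.
move=> ok zs; rewrite (ss_ins ok) => yz; apply: (ss_order ok) => // -[_ zw].
by move: (ss_disj ok (so_root (ss_fwd ok))); rewrite -zw zs.
Qed.

Lemma search_ok_pairs c w hh sr : search_ok c w hh sr ->
  size hh * size hh <= 2 * #|newly_related (edge c) (order c) (source sr) w|.
Proof.
move=> ok; apply: pairs_newly_related (ss_pairs ok).
- exact: so_uniq (ss_fwd ok).
- exact: so_uniq (ss_bwd ok).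
- move=> u x /(so_hist (ss_fwd ok))[us ux _]; split=> //.
  exact: so_reach (ss_fwd ok) _ us.
- move=> z y /(so_hist (ss_bwd ok))[zs zy _].
  split; first by rewrite /edge -(ss_ins ok).
  have := so_reach (ss_bwd ok) zs.
  rewrite (@eq_connect _ _ [rel a b | edge c b a]) => [|a b].
    by rewrite connect_rev.
  by rewrite /= /edge (ss_ins ok).
Qed.

(** * Correctness and time of the reordering *)

Section Reorder.
Variables (c : config V) (w : V) (hh : seq ((V * V) * (V * V))).
Variables (sr : search V) (sort : {set V} -> seq V).
Hypotheses (ok : search_ok c w hh sr) (set : settled sr).
Hypothesis ended : (active (fwd sr) == set0) || (active (bwd sr) == set0).
Hypothesis sortP : forall S : {set V},
  (exists l, topological (edge c) S l) -> topological (edge c) S (sort S).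

Let ord := order c.
Let F := seen (fwd sr).
Let B := seen (bwd sr).
Let v := source sr.
Let t := [arg min_(x < v in v |: [set x in F | ~~ nilp (ptr (fwd sr) x)])
            index x ord].
Let Flt := [set x in F | olt ord x t].
Let Bgt := [set y in B | olt ord t y].

(** When the loop ends one side has no live vertex, so [separated] applies to every such pair. *)
Let apart x z : x \in F -> ptr (fwd sr) x != [::] ->
  z \in B -> ptr (bwd sr) z != [::] -> olt ord z x.
Proof.
case: (ss_sep ok) => sep _ _ xF xp zB zp; apply: sep => //.
case/orP: ended => /eqP a; rewrite /live a.
  by rewrite set.1 // setU0 inE.
by rewrite set.2 // setU0 in_set0 orbT.
Qed.

Let tP : [/\ (t == v) || (t \in F) && (ptr (fwd sr) t != [::]),
             index t ord <= index v ord &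
             forall x, x \in F -> ptr (fwd sr) x != [::] ->
               index t ord <= index x ord].
Proof.
rewrite /t; case: arg_minnP => [|x]; first by rewrite !inE eqxx.
rewrite !inE => xP xmin; split.
- by move: xP; case: (ptr _ x).
- by apply: xmin; rewrite !inE eqxx.
- move=> y yF yp; apply: xmin; rewrite !inE yF /=.
  by case: (ptr _ y) yp => //=; rewrite orbT.
Qed.

Let Flt_nil x : x \in Flt -> ptr (fwd sr) x = [::].
Proof.
rewrite inE => /andP[xF xt]; apply/eqP; apply: contraLR xt => xp.
by case: tP => _ _ /(_ x xF xp); rewrite /olt -leqNgt.
Qed.

Let Flt_out x y : x \in Flt -> y \in outs c x -> y \in F.
Proof.
move=> xF; have xs : x \in F by move: xF; rewrite inE => /andP[].
have [l -> lF] := so_suffix (ss_fwd ok) xs.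
by rewrite Flt_nil // cats0; apply: lF.
Qed.

(** A path of reversed arcs from [v] can be taken without repeated vertices; then none of its arcs
    has tail [v], so the new arc is avoided and the old order decreases along it. *)
Let B_le_v z : z \in B -> index z ord <= index v ord.
Proof.
move=> zB; have := so_reach (ss_bwd ok) zB.
rewrite (@eq_connect _ _ (fun a b => edge c b a)) => [|a b]; last first.
  by rewrite /edge (ss_ins ok).
move=> /connectP[p pp ->]; case/shortenP: pp => p' pp' up' _.
move: up' => /= /andP[vp' _].
suff : forall a, path (fun a b => edge c b a) a p' ->
  index (last a p') ord <= index a ord by apply.
elim: p' vp' {pp'} => // b p' IH; rewrite inE negb_or => /andP[vb /IH{}IH] a /=.
move=> /andP[ba /IH]; move=> /leq_trans; apply; apply/ltnW.
by apply: (ss_order ok) => // -[bv _]; rewrite bv eqxx in vb.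
Qed.

Let Bgt_nil y : y \in Bgt -> ptr (bwd sr) y = [::].
Proof.
rewrite inE => /andP[yB ty]; apply/eqP; apply: contraLR ty => yp.
rewrite /olt -leqNgt; case: tP => /orP[/eqP -> _ _|/andP[tF tp] _ _].
  exact: B_le_v.
exact/ltnW/apart.
Qed.

Let Bgt_in x y : y \in Bgt -> x \in ins c y -> x \in B.
Proof.
move=> yB; have ys : y \in B by move: yB; rewrite inE => /andP[].
have [l -> lB] := so_suffix (ss_bwd ok) ys.
by rewrite Bgt_nil // cats0; apply: lB.
Qed.

(** A set missing an end of the new arc is still ordered topologically by the old order. *)
Let sort_sub (S : {set V}) : (v \notin S) || (w \notin S) ->
  topological (edge c) S (sort S).
Proof.
move=> vw; apply: sortP; exists [seq x <- ord | x \in S].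
apply: topological_filter (ss_perm ok) _ => x y xS yS xy.
apply: (ss_order ok) => // -[xv yw]; move: vw.
by rewrite -yw -[v]/(source sr) -xv xS yS.
Qed.

Let notF x : x \in B -> x \notin F.
Proof. by apply: contraL; apply: (ss_disj ok). Qed.

Let vB : v \in B.
Proof. exact: so_root (ss_bwd ok). Qed.

Let wF : w \in F.
Proof. exact: so_root (ss_fwd ok). Qed.

Let sortF : topological (edge c) Flt (sort Flt).
Proof. by apply: sort_sub; rewrite !inE (negPf (notF vB)). Qed.

Let sortB : topological (edge c) Bgt (sort Bgt).
Proof. by apply: sort_sub; rewrite !inE (negPf (ss_disj ok wF)) orbT. Qed.

Let mem_sort (S : {set V}) :
  topological (edge c) S (sort S) -> sort S =i S /\ uniq (sort S).
Proof.
case=> ps _; split; last by rewrite (perm_uniq ps) enum_uniq.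
by move=> x; rewrite (perm_mem ps) mem_enum.
Qed.

Let olt_le x y : (x == y = false) -> index x ord <= index y ord -> olt ord x y.
Proof.
rewrite /olt leq_eqVlt => xy /orP[/eqP e|//].
by rewrite (index_inj x _ _ e) ?eqxx ?(perm_mem_enum _ (ss_perm ok)) in xy.
Qed.

(** The lists of [Flt] and [Bgt] were traversed completely, so arcs leaving [Flt] end in [F] and
    arcs entering [Bgt] start in [B]. Hence an arc with one end in the moved block has its other end
    on the right side of [t]. The new arc is repaired as [w] moves after [v = t], or [v] moves
    before [t] and, if [w] is before [t], also before [w]. *)
Lemma reorder_eq :
  let ord' := order (reorder sort sr c) in
  perm_eq ord' (enum V) /\ forall x y, edge c x y -> olt ord' x y.
Proof.
have [Fm Fu] := mem_sort sortF; have [Bm Bu] := mem_sort sortB.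
have po := ss_perm ok.
rewrite /reorder /= -/ord -/F -/B -/v -/t -/Flt -/Bgt.
have [tP1 tv tF] := tP.
have out_blk x y : x \in Flt -> edge c x y -> y \notin Flt ->
    index t ord <= index y ord /\ y \notin B.
  move=> xF xy; have yF := Flt_out xF xy.
  by rewrite inE yF /olt -leqNgt; split=> //; apply: (ss_disj ok).
have in_Flt x y : y \in Flt -> edge c x y -> x != v ->
    olt ord x t /\ olt ord x y.
  rewrite inE => /andP[yF yt] xy xv.
  have xy' : olt ord x y.
    by apply: (ss_order ok) => // -[xv' _]; rewrite xv' eqxx in xv.
  by split=> //; apply: ltn_trans yt.
case: eqVneq => [tv'|tnv].
  rewrite /insert_after; set blk := sort Flt.
  rewrite (@eq_filter _ _ [pred x | x \notin blk]) => [|x]; last by rewrite /= Fm.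
  have tblk : t \notin blk by rewrite Fm inE /olt ltnn andbF.
  have idx a : a \notin blk -> index a [seq x <- ord | x \notin blk] <
      (index t [seq x <- ord | x \notin blk]).+1 = (index a ord <= index t ord).
    move=> ab; rewrite ltnS leqNgt [RHS]leqNgt; congr (~~ _).
    exact: (@olt_filter _ [pred x | x \notin blk]).
  split; first exact: perm_insert.
  move=> x y xy; case: (boolP (x \in blk)) => xb; case: (boolP (y \in blk)) => yb.
  - rewrite olt_insert_block //.
    by case: sortF => _; apply; rewrite -?Fm.
  - have [ty yB] : index t ord <= index y ord /\ y \notin B.
      by apply: (out_blk x); rewrite -?Fm.
    apply: olt_insert_after => //; rewrite ltnNge -ltnS idx // -ltnNge.
    apply: (@olt_le t y) => //; apply/eqP => e.
    by move: yB; rewrite -e tv' vB.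
  - apply: olt_insert_before => //; rewrite idx //.
    case: (eqVneq x v) => [->|xv]; first by rewrite tv'.
    by rewrite Fm in yb; case: (in_Flt x y) => // /ltnW.
  - rewrite olt_insert_rest //; apply: (ss_order ok) => // -[_ yw].
    by move: yb; rewrite Fm yw inE wF tv' [olt _ _ _](ss_back ok).
have [tF' tp] : t \in F /\ ptr (fwd sr) t != [::].
  by move: tP1; rewrite (negPf tnv) => /andP.
have tv'' : olt ord t v by apply: olt_le; rewrite // (negPf tnv).
rewrite /insert_before; set blk := sort Bgt ++ sort Flt.
have blkE x : (x \in blk) = (x \in Bgt) || (x \in Flt).
  by rewrite mem_cat Fm Bm.
rewrite (@eq_filter _ _ [pred x | x \notin blk]) => [|x]; last first.
  by rewrite /= blkE negb_or andbC.
have BgtF x : x \in Bgt -> x \notin Flt.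
  by rewrite !inE => /andP[/notF /negPf ->].
have blku : uniq blk.
  rewrite cat_uniq Fu Bu andbT; apply/hasPn => x; rewrite /= Fm Bm.
  by apply: contraL => /BgtF.
have tblk : t \notin blk by rewrite blkE !inE /olt ltnn !andbF.
have idx a : a \notin blk -> (index a [seq x <- ord | x \notin blk] <
    index t [seq x <- ord | x \notin blk]) = (index a ord < index t ord).
  by move=> ab; apply: (@olt_filter _ [pred x | x \notin blk]).
split; first exact: perm_insert.
move=> x y xy; case: (boolP (x \in blk)) => xb; case: (boolP (y \in blk)) => yb.
- rewrite olt_insert_block //; move: xb yb; rewrite !blkE.
  rewrite /olt /blk !index_cat Bm Bm.
  case: (boolP (x \in Bgt)) => xB /=; case: (boolP (y \in Bgt)) => yB /= xF yF.
  + by case: sortB => _; apply.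
  + by rewrite ltn_addr // index_mem Bm.
  (* No arc leads from [Flt] to [Bgt], as its tail would be in both [F] and [B]. *)
  + have xBs : x \in B by apply: (Bgt_in yB); rewrite (ss_ins ok).
    by move: xF; rewrite inE (negPf (notF xBs)).
  + by rewrite ltn_add2l; case: sortF => _; apply.
- apply: olt_insert_after => //; rewrite leqNgt idx // -leqNgt.
  move: xb yb; rewrite !blkE negb_or => /orP[xB|xF] /andP[yB yF].
    case: (eqVneq x v) => [xv|xv].
      case: (eqVneq y w) => [yw|yw].
        by move: yF; rewrite yw inE wF -leqNgt.
      have xy' : olt ord x y.
        by apply: (ss_order ok) => // -[_ yw']; rewrite yw' eqxx in yw.
      by apply/ltnW/(ltn_trans _ xy'); rewrite xv.
    have xy' : olt ord x y.
      by apply: (ss_order ok) => // -[xv' _]; rewrite xv' eqxx in xv.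
    by apply/ltnW/(ltn_trans _ xy'); move: xB; rewrite inE => /andP[].
  by have [] := out_blk x y xF xy yF.
- apply: olt_insert_before => //; rewrite idx //.
  move: xb yb; rewrite !blkE negb_or => /andP[xB xF] /orP[yB|yF].
    have xBs : x \in B by apply: (Bgt_in yB); rewrite (ss_ins ok).
    apply: olt_le; last by move: xB; rewrite inE xBs -leqNgt.
    by apply/eqP => xt; move: (notF xBs); rewrite xt tF'.
  case: (in_Flt x y yF xy) => //; apply: contraNneq xB => ->.
  by rewrite inE vB.
- rewrite olt_insert_rest //; apply: (ss_order ok) => // -[xv _].
  by move: xb; rewrite blkE xv inE vB [olt _ _ _]tv''.
Qed.

(** With k traversed arcs a side has at most k + 1 seen vertices, and the moved ones, being
    exhausted, have at most k arcs in all. This gives 3 k + 2 per side. *)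
Lemma reorder_clock :
  clock (reorder sort sr c) <= clock c + 6 * size hh + 5.
Proof.
rewrite /reorder /= -/ord -/F -/B -/v -/t -/Flt -/Bgt.
have count (T : side V) adj r (h : seq (V * V)) (S : {set V}) :
    side_ok adj r h T -> S \subset seen T ->
    (forall x, x \in S -> ptr T x = [::]) ->
    #|seen T| + \sum_(x in S) (size (adj x)).+1 <= 3 * size h + 2.
  move=> okT sub nil.
  have -> : \sum_(x in S) (size (adj x)).+1 = #|S| + \sum_(x in S) size (adj x).
    by rewrite -sum1_card -big_split.
  have := subset_leq_card sub; have := so_card okT; have := so_sum okT.
  rewrite (big_setID S) [X in _ = _ + X](big_setID S) /= (setIidPr sub).
  rewrite [X in _ = _ + (X + _)]big1 => [|x /nil ->//].
  have : \sum_(x in seen T :\: S) size (ptr T x) <=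
         \sum_(x in seen T :\: S) size (adj x).
    apply: leq_sum => x /setDP[xs _]; have [l -> _] := so_suffix okT xs.
    by rewrite size_cat leq_addl.
  lia.
have F1 := count _ _ _ _ Flt (ss_fwd ok) _ Flt_nil.
have B1 := count _ _ _ _ Bgt (ss_bwd ok) _ Bgt_nil.
rewrite size_map in F1; rewrite size_map in B1.
have sub (A : {set V}) p : [set x in A | p x] \subset A.
  by apply/subsetP => x; rewrite inE => /andP[].
have {}F1 := F1 (sub _ _); have {}B1 := B1 (sub _ _).
rewrite -/F in F1; rewrite -/B in B1; lia.
Qed.

End Reorder.


(** * One iteration of the search loop *)

Lemma search_step_traverse c w hh sr u z x y rest rest' :
  search_ok c w hh sr -> u \in active (fwd sr) -> z \in active (bwd sr) ->
  olt (order c) u z ->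
  ptr (fwd sr) u = x :: rest -> ptr (bwd sr) z = y :: rest' ->
  x \notin seen (bwd sr) -> y \notin x |: seen (fwd sr) ->
  let sr' := Search (source sr)
               (discover (outs c) x (advance u (fwd sr)))
               (discover (ins c) y (advance z (bwd sr))) (threshold sr) in
  [/\ search_ok c w (((u, x), (z, y)) :: hh) sr',
      search_measure c sr' < search_measure c sr &
      search_potential c sr' <= search_potential c sr + 40].
Proof.
move=> ok uA zA uz pu pz xB yF sr'.
have okF := ss_fwd ok; have okB := ss_bwd ok.
have [_ tr _] := olt_strict_total (ss_perm ok).
have us : u \in seen (fwd sr) by case: (so_live okF (x := u)); rewrite // inE uA.
have zs : z \in seen (bwd sr) by case: (so_live okB (x := z)); rewrite // inE zA.
have ux := search_ok_lt_fwd ok us (traverse_arc okF uA pu).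
have yz := search_ok_lt_bwd ok zs (traverse_arc okB zA pz).
have VF : #|active (fwd sr')| <= #|V| by apply: max_card.
have VB : #|active (bwd sr')| <= #|V| by apply: max_card.
split.
- split=> /=; try by case: ok.
  + exact: traverse_ok okF uA pu (ss_uouts ok u).
  + exact: traverse_ok okB zA pz (ss_uins ok z).
  + move=> a; rewrite !traverse_seen !in_setU1 negb_or.
    move=> /orP[/eqP ->|aF]; first rewrite xB andbT.
      by apply: contraNneq yF => ->; rewrite in_setU1 eqxx.
    rewrite (ss_disj ok aF) andbT; apply: contraNneq yF => <-.
    by rewrite in_setU1 aF orbT.
  + by rewrite uz (ss_pairs ok).
  + apply: (traverse_separated (root := w) (h := unzip1 hh) okF uA pu tr ux).
    apply: (@separated_flip _ (fun a b => olt (order c) b a)).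
    apply: (traverse_separated (root := source sr) (h := unzip2 hh) okB zA pz) => //.
      by move=> b a d ab bd; apply: tr bd ab.
    exact/separated_flip/(ss_sep ok).
- apply: lex_ltn; last by move: VF VB; rewrite /sr' /=; lia.
  have := traverse_work okF uA pu; have := traverse_work okB zA pz.
  rewrite /sr' /=; case: (_ || _); case: (_ || _) => /=; lia.
- have := traverse_weight (x := x) okF uA pu (olt (order c)) (threshold sr).
  have := traverse_weight (x := y) okB zA pz (fun a b => olt (order c) b a)
    (threshold sr).
  rewrite /search_potential /potential /=; lia.
Qed.

(** As [F] and [B] are disjoint, z < u holds strictly, so s < u or z < s: at least one vertex
    becomes passive and frees 3 units. *)
Lemma search_step_deactivate c w hh sr u z :
  search_ok c w hh sr -> u \in active (fwd sr) -> z \in active (bwd sr) ->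
  ~~ olt (order c) u z ->
  let s := threshold sr in
  let sr' := Search (source sr)
               (if olt (order c) s u then deactivate u (fwd sr) else fwd sr)
               (if olt (order c) z s then deactivate z (bwd sr) else bwd sr) s in
  [/\ search_ok c w hh sr',
      search_measure c sr' < search_measure c sr &
      search_potential c sr' + 3 <= search_potential c sr].
Proof.
move=> ok uA zA uz s sr'.
have okF := ss_fwd ok; have okB := ss_bwd ok.
have st := olt_strict_total (ss_perm ok); have [irr tr tot] := st.
have us : u \in seen (fwd sr) by case: (so_live okF (x := u)); rewrite // inE uA.
have zs : z \in seen (bwd sr) by case: (so_live okB (x := z)); rewrite // inE zA.
have su_zs : olt (order c) s u || olt (order c) z s.
  have uz' : u != z by apply: contraTneq zs => <-; exact: (ss_disj ok us).
  have zu : olt (order c) z u by move: (tot _ _ uz'); rewrite (negPf uz).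
  case: (eqVneq s u) => [->|/tot /orP[->//|us']]; first by rewrite zu orbT.
  by rewrite (tr _ _ _ zu us') orbT.
have irr' : irreflexive (fun a b => olt (order c) b a) by move=> a; apply: irr.
have F' := deactivate_live uA; have B' := deactivate_live zA.
have wF : work (outs c) (deactivate u (fwd sr)) <= work (outs c) (fwd sr).
  by apply: work_sub; rewrite ?F'.
have wB : work (ins c) (deactivate z (bwd sr)) <= work (ins c) (bwd sr).
  by apply: work_sub; rewrite ?B'.
have cF := deactivate_card uA; have cB := deactivate_card zA.
have sep1 : separated (olt (order c)) (fwd sr') (bwd sr) s.
  rewrite /sr' /=; case: ifP => su; last exact: ss_sep ok.
  by apply: deactivate_separated => //; exact: ss_sep ok.
split.
- split=> /=; try by case: ok.
  + by case: ifP => _ //; apply: deactivate_ok.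
  + by case: ifP => _ //; apply: deactivate_ok.
  + by move=> a; have := ss_disj ok (x := a); case: ifP; case: ifP.
  + case: (boolP (olt (order c) z s)) => // lt.
    apply: (@separated_flip _ (fun a b => olt (order c) b a)).
    by apply: deactivate_separated => //; apply/separated_flip.
- rewrite /search_measure /measure /sr' /=.
  have mF : olt (order c) s u ->
      (s \in active (deactivate u (fwd sr))) = (s \in active (fwd sr)).
    by move=> su; apply: (deactivate_mem (lt := olt (order c))).
  have mB : olt (order c) z s ->
      (s \in active (deactivate z (bwd sr))) = (s \in active (bwd sr)).
    by move=> lt; apply: (deactivate_mem (lt := fun a b => olt (order c) b a)).
  rewrite -/s in mF mB *.
  set X := (_ || _); set Y := (_ || _).
  have -> : X = Y.
    rewrite /X /Y; congr (_ || _).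
      by case: ifP => // /mF.
    by case: ifP => // /mB.
  rewrite -addnS leq_add // ?leq_mul2r /= ?leq_add2r ?leq_mul2l ?leq_add //.
  + by case: ifP.
  + by case: ifP.
  + move: su_zs; case: ifP => _; case: ifP => _ //= _; rewrite -?addSn.
    * by rewrite leq_add // ltnW.
    * by rewrite leq_add.
    * by rewrite addSn -addnS leq_add.
- rewrite /search_potential /potential /= -/s.
  have dF : weight (olt (order c)) (fwd sr') s + 3 * olt (order c) s u <=
      weight (olt (order c)) (fwd sr) s.
    rewrite /sr' /=; case: ifP => h; last by rewrite addn0.
    by rewrite muln1; apply: deactivate_weight.
  have dB : weight (fun a b => olt (order c) b a) (bwd sr') s +
      3 * olt (order c) z s <= weight (fun a b => olt (order c) b a) (bwd sr) s.
    rewrite /sr' /=; case: ifP => h; last by rewrite addn0.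
    by rewrite muln1; apply: (deactivate_weight (lt := fun a b => olt _ b a)).
  apply: leq_trans (leq_add dF dB); rewrite [X in _ <= X]addnACA leq_add2l.
  by move: su_zs; do 2 case: olt.
Qed.

(** The second half is the first with the sides exchanged and the order reversed. If it leaves the
    forward side without active vertices, it has also emptied its passive set or found it empty. *)
Lemma spec_refill_both (R : realType) c w hh sr :
  search_ok c w hh sr ->
  spec (refill_both R (order c) sr)
    (fun p => [/\ search_ok c w hh p.2, settled p.2, source p.2 = source sr &
                  search_measure c p.2 <= search_measure c sr])
    (fun p => (p.1 + search_potential c p.2)%:R%R)
    (2 + search_potential c sr)%:R%R.
Proof.
move=> ok; have st := olt_strict_total (ss_perm ok).
have leE x y : ole (order c) x y = ~~ olt (order c) y x by rewrite /ole /olt -leqNgt.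
have -> : 2 + search_potential c sr = (1 + search_potential c sr) + 1 by lia.
rewrite natrD /refill_both.
apply: spec_bindD (spec_refill R st leE (ss_fwd ok) (ss_bwd ok) (ss_sep ok)) _.
move=> [[[t1 F'] B'] s'] [[okF okB sep] [sF sB pF pB] setF _ mF].
have H := spec_refill R (strict_total_flip st)
  (le := fun x y => ole (order c) y x) (fun x y => leE y x)
  okB okF (separated_flip sep).
have -> : ((t1 + potential (olt (order c)) F' B' s')%:R + 1 =
    (1 + potential (fun x y => olt (order c) y x) B' F' s')%:R + t1%:R :> R)%R.
  rewrite natr1 -natrD (potential_flip (olt (order c))).
  by congr (_%:R)%R; lia.
apply: spec_bindD H _.
move=> [[[t2 B''] F''] s''] [[okB' okF' sep'] [sB' sF' pB' pF'] setB setF' mB].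
apply: spec_ret => /=.
  split=> //.
  - split=> /=; try by case: ok.
      by move=> x; rewrite sF' sF sB' sB; apply: (ss_disj ok).
    exact: separated_flip sep'.
  - by split=> //=; apply: setF'.
  - apply: leq_trans mF; rewrite /search_measure /= /measure.
    move: mB; rewrite /measure.
    by rewrite [work (ins c) _ + _]addnC [work (ins c) B' + _]addnC
      [(_ \in active B'') || _]orbC [(_ \in active B') || _]orbC
      [#|active B''| + _]addnC [#|active B'| + _]addnC.
rewrite (potential_flip (olt (order c))) -natrD ler_nat /search_potential /=; lia.
Qed.

End SearchSteps.

(** * Runs of the algorithm and their halting *)

Section Runs.
Local Open Scope ring_scope.
Variables (R : realType) (V : finType) (r : resolver V).
Implicit Types (c : config V) (tr : trace V).

(** Recursion on the first step, which suits backward induction; [run] recurses on the last one, and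
    [expectation_run] reconciles the two. *)
Fixpoint final_clock (k : nat) tr : R :=
  if k is k'.+1 then
    expectation (step R r tr) (fun c => final_clock k' (c, tr.1 :: tr.2))
  else (clock tr.1)%:R.

Fixpoint halts_within (k : nat) tr : bool :=
  if k is k'.+1 then
    surely (step R r tr) (fun c => halts_within k' (c, tr.1 :: tr.2))
  else halted tr.1.

Lemma surely_bind A B (d : dist R A) (f : A -> dist R B) P :
  surely (dbind d f) P = surely d (fun a => surely (f a) P).
Proof.
rewrite /surely; elim: d => //= p d IH; rewrite -IH /dbind /= all_cat.
by rewrite all_map.
Qed.

Lemma expectation_run c0 i j :
  expectation (run R r c0 j) (final_clock i) = final_clock (i + j) (c0, [::]).
Proof.
elim: j i => [|j IH] i; first by rewrite /= expectation_ret addn0.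
rewrite addnS -addSn -IH /= expectation_bind; apply: eq_bigr => p _.
rewrite expectation_bind; congr (_ * _); apply: eq_bigr => c _.
by rewrite expectation_ret.
Qed.

Lemma surely_run c0 i j :
  surely (run R r c0 j) (halts_within i) = halts_within (i + j) (c0, [::]).
Proof.
elim: j i => [|j IH] i; first by rewrite /= andbT addn0.
rewrite addnS -addSn -IH /= surely_bind; apply: eq_all => p.
by rewrite surely_bind; apply: eq_all => c /=; rewrite andbT.
Qed.

Lemma step_halted tr : halted tr.1 -> step R r tr = dret R tr.1.
Proof. by rewrite /step => ->. Qed.

Lemma final_clock_halted k tr :
  halted tr.1 -> final_clock k tr = (clock tr.1)%:R.
Proof.
elim: k tr => //= k IH tr h; rewrite step_halted // expectation_ret.
by rewrite IH.
Qed.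

Lemma halts_withinS k tr : halts_within k tr -> halts_within k.+1 tr.
Proof.
elim: k tr => [|k IH] tr; first by rewrite /= => h; rewrite step_halted //= h.
by apply: sub_all => p; apply: IH.
Qed.

Lemma halts_within_leq k k' tr :
  (k <= k')%N -> halts_within k tr -> halts_within k' tr.
Proof.
by move=> /subnK <-; elim: (k' - k)%N => // n IH /IH/halts_withinS.
Qed.

(** The support is finite, so the maximum of the individual bounds serves all outcomes. *)
Lemma halts_step tr :
  almost_surely (step R r tr)
    (fun c => exists k, halts_within k (c, tr.1 :: tr.2)) ->
  exists k, halts_within k tr.
Proof.
move=> H; suff [k kP] : exists k, surely (step R r tr)
    (fun c => halts_within k (c, tr.1 :: tr.2)) by exists k.+1.
elim: (step R r tr) H => [_|p d IH [[_ [k kP]] /IH[k' kP']]]; first by exists 0%N.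
exists (maxn k k'); rewrite /= (halts_within_leq (leq_maxl _ _) kP) /=.
apply: sub_all kP' => q; apply: halts_within_leq; exact: leq_maxr.
Qed.

(** * Amortized analysis of a run, with [q] standing for sqrt m *)

Record graph_ok (arcs added : seq (V * V)) c : Prop := GraphOk {
  go_arcs : arcs = added ++ todo c;
  go_outs : forall x y, (y \in outs c x) = ((x, y) \in added);
  go_ins : forall x y, (x \in ins c y) = ((x, y) \in added);
  go_uouts : forall x, uniq (outs c x);
  go_uins : forall x, uniq (ins c x) }.

Variables (arcs : seq (V * V)) (q : R).
Hypotheses (arcs_uniq : uniq arcs) (q1 : 1 <= q).
Hypothesis qq : q * q = (size arcs)%:R.

(* What the additions still to come are allowed to cost: O(sqrt m) each, plus
   O(1 / sqrt m) for every pair of arcs that is not related yet. *)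
Definition reserve c : R :=
  72 * q * (size (todo c))%:R +
  49 / q * ((size arcs * size arcs)%:R - #|related (edge c)|%:R).

(* Every traversed pair of arcs uses up 43 units during the search and 6 in the
   reordering; since k pairs make k ^ 2 / 2 pairs of arcs newly related, the
   total 49 k is at most 49 / q * (k ^ 2 / 2) + 49 / 2 * q. *)
Definition search_reserve c w (hh : seq ((V * V) * (V * V))) v : R :=
  49 / q * #|newly_related (edge c) (order c) v w|%:R + 49 / 2 * q + 6
  - 43 * (size hh)%:R.

Definition charge c : R :=
  if searching c is Some sr then (search_potential c sr)%:R else 0.

(** The invariant of the backward induction: [b] covers the clock and all that is set aside for the
    rest of the run. *)
Inductive bounded c (b : R) : Prop :=
| BoundedHalted of halted c & (clock c)%:R <= b
| BoundedIdle added of graph_ok arcs added c & searching c = None &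
    cyclic c = false & perm_eq (order c) (enum V) &
    (forall x y, edge c x y -> olt (order c) x y) &
    reserve c + (clock c)%:R <= b
| BoundedSearch added w hh sr of graph_ok arcs added c &
    searching c = Some sr & cyclic c = false & search_ok c w hh sr &
    settled sr &
    charge c + (clock c)%:R + reserve c + search_reserve c w hh (source sr) <= b.

Let q0 : 0 < q. Proof. exact: lt_le_trans q1. Qed.

Let q49 : 0 <= 49 / q. Proof. by rewrite divr_ge0 // ltW. Qed.

Lemma reserve_ge0 added c : graph_ok arcs added c -> 0 <= reserve c.
Proof.
move=> ok; apply: addr_ge0; first by rewrite !mulr_ge0 // ltW.
apply: mulr_ge0 => //; rewrite subr_ge0 ler_nat.
have rel : (#|related (edge c)| <= size added * size added)%N.
  by apply: card_related => x y; rewrite /edge (go_outs ok).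
by apply: leq_trans rel _; rewrite (go_arcs ok) leq_mul // size_cat leq_addr.
Qed.

(** From k^2 <= 2 N and 2 k q <= k^2 + q^2 follows k <= N / q + q / 2. Of the 49 k so covered 43 k
    are spent, and the rest pays for the reordering. *)
Lemma search_reserve_ge c w hh sr : search_ok c w hh sr ->
  6 * (size hh)%:R + 6 <= search_reserve c w hh (source sr).
Proof.
move=> /search_ok_pairs; rewrite -(ler_nat R) !natrM /search_reserve.
set k := (size hh)%:R; set N := #|_|%:R => kN.
suff : k <= N / q + q / 2.
  rewrite mulrAC -mulrA; set a := N / q => ?; lra.
rewrite -(ler_pM2r q0) mulrDl divfK ?gt_eqF //.
have : 0 <= (k - q) * (k - q) by rewrite -expr2 sqr_ge0.
nra.
Qed.

Lemma bounded_halted c (b : R) : bounded c b -> halted c -> (clock c)%:R <= b.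
Proof.
case=> [//|added ok _ _ _ _ cb _|added w hh sr _ e cy _ _ _].
  by apply: le_trans cb; rewrite lerDr; apply: reserve_ge0 ok.
by rewrite /halted e cy andbF.
Qed.

(** The successor makes the end of a search count as progress too. *)
Definition remaining c : nat :=
  if searching c is Some sr then (search_measure c sr).+1 else 0%N.

Definition decreases c' c : Prop :=
  (size (todo c') < size (todo c))%N \/
  (todo c' = todo c /\ (remaining c' < remaining c)%N).

Lemma add_arc_graph added c front v w arcs' : graph_ok arcs added c ->
  todo c = (v, w) :: arcs' ->
  graph_ok arcs (rcons added (v, w)) (add_arc front v w arcs' c).
Proof.
move=> ok tE; have vw : (v, w) \notin added.
  have := arcs_uniq; rewrite (go_arcs ok) tE cat_uniq /= => /and3P[_ + _].
  by rewrite negb_or => /andP[].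
split=> /=.
- by rewrite cat_rcons -tE (go_arcs ok).
- move=> x y; rewrite mem_rcons inE xpair_eqE -(go_outs ok).
  by case: eqVneq => //= ->; case: front; rewrite ?mem_rcons inE.
- move=> x y; rewrite mem_rcons inE xpair_eqE andbC -(go_ins ok).
  by case: eqVneq => //= ->; case: front; rewrite ?mem_rcons inE.
- move=> x; case: eqVneq => [_|_]; last exact: (go_uouts ok).
  by case: front; rewrite /= ?rcons_uniq (go_outs ok) vw (go_uouts ok).
- move=> x; case: eqVneq => [_|_]; last exact: (go_uins ok).
  by case: front; rewrite /= ?rcons_uniq (go_ins ok) vw (go_uins ok).
Qed.

(** The step releases [72 * q] and the share of the newly related pairs. Starting a search needs 1
    for the clock, 40 for the potential and 49 / 2 q + 6 for its reserve, at most 72 q in all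
    because q >= 1. *)
Lemma add_arc_bounded added c front v w arcs' (b : R) : graph_ok arcs added c ->
  todo c = (v, w) :: arcs' -> perm_eq (order c) (enum V) ->
  (forall x y, edge c x y -> olt (order c) x y) ->
  reserve c + (clock c)%:R <= b -> bounded (add_arc front v w arcs' c) b.
Proof.
move=> ok tE po topo cb; have ok' := add_arc_graph front ok tE.
set c' := add_arc _ _ _ _ _ in ok' *.
have edgeE x y : edge c' x y = ((x, y) == (v, w)) || edge c x y.
  by rewrite /edge (go_outs ok') mem_rcons inE -(go_outs ok).
have vwE : edge c' v w by rewrite edgeE eqxx.
have rel := card_newly_related (ord := order c) (e' := edge c')
  (fun x y h => etrans (edgeE x y) (introT orP (or_intror h))) vwE topo.
have clockE : (clock c')%:R = (clock c)%:R + 1 :> R by rewrite /= natr1.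
have reserveE : reserve c' + 72 * q +
    49 / q * #|newly_related (edge c') (order c) v w|%:R <= reserve c.
  rewrite /reserve tE [todo c']/= -[size (_ :: _)]/((size arcs').+1) -natr1.
  move: rel; rewrite -(ler_nat R) natrD => rel.
  have := ler_wpM2l q49 rel; rewrite mulrDr; set a := 49 / q.
  rewrite !mulrBr; lra.
pose a : R := 49 / q * #|newly_related (edge c') (order c) v w|%:R.
rewrite -/a in reserveE; have q1' := q1.
have a0 : 0 <= a by apply: mulr_ge0.
have [vw|vw] := eqVneq v w.
  apply: BoundedHalted; first by rewrite /halted /= vw eqxx.
  have res0 := reserve_ge0 ok'; rewrite clockE; lra.
have cy : cyclic c' = false by rewrite /= (negPf vw).
have [irr _ tot] := olt_strict_total po.
case: (boolP (olt (order c) w v)) => wv; last first.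
  apply: (BoundedIdle (added := rcons added (v, w))) => //.
  - by rewrite /= (negPf wv).
  - move=> x y; rewrite edgeE => /orP[/eqP[-> ->]|/topo //].
    by move: (tot _ _ vw); rewrite (negPf wv) orbF.
  - by rewrite clockE; lra.
have srE : searching c' = Some (Search v (start_side (outs c') w)
    (start_side (ins c') v) v) by rewrite /= wv.
apply: (BoundedSearch (added := rcons added (v, w)) (w := w) (hh := [::])
  _ srE) => //.
- split=> //=.
  + by move=> x y; rewrite (go_ins ok') (go_outs ok').
  + exact: (go_uouts ok').
  + exact: (go_uins ok').
  + by move=> x y; rewrite edgeE => /orP[/eqP|/topo].
  + exact: start_side_ok.
  + exact: start_side_ok.
  + by move=> x; rewrite !inE => /eqP ->; rewrite eq_sym.
  + exact: separated_start.
- have potE : (search_potential c' (Search v (start_side (outs c') w)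
      (start_side (ins c') v) v) <= 40)%N.
    by rewrite (leq_add (n1 := 20) (n2 := 20)) ?weight_start.
  rewrite /charge srE clockE /search_reserve [source _]/= [Defs.order c']/=.
  move: potE; rewrite -(ler_nat R) => potE; rewrite [size [::]]/= mulr0 subr0.
  rewrite -/a; lra.
Qed.

(** A supermartingale property: the bounds [g] of the successors average to at most [b]. *)
Lemma step_bounded tr (b : R) : admissible r -> bounded tr.1 b -> ~~ halted tr.1 ->
  exists g, spec (step R r tr)
    (fun c' => bounded c' (g c') /\ (halted c' \/ decreases c' tr.1)) g b.
Proof.
case: tr => c past [pickP sortP] /= [h _ /negP[]//|added ok sE cy po topo cb|].
  move=> nh; exists (fun=> b); rewrite /step (negPf nh) /= sE.
  case tE: (todo c) => [|[v w] arcs'].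
    by move: nh; rewrite /halted cy sE tE.
  apply: spec_ret => //; split; first exact: add_arc_bounded ok tE po topo cb.
  by right; left; rewrite tE.
move=> added w hh sr ok sE cy sok set cb nh.
rewrite /step (negPf nh) /= sE.
have res0 := reserve_ge0 ok; have sres := search_reserve_ge sok.
have hh0 : 0 <= (size hh)%:R :> R by [].
case: ifP => [ended|/negbT].
  have [po topo] := reorder_eq sok set ended (fun S => sortP (c, past) S).
  have := reorder_clock (static_sort r (c, past)) sok set ended.
  set c' := reorder _ _ _ in po topo *; move=> ck.
  exists (fun=> b); apply: spec_ret => //; split; last first.
    by right; right; rewrite /remaining sE.
  apply: (BoundedIdle (added := added)) => //; first by case: ok.
  have -> : reserve c' = reserve c by [].
  move: (clock c') ck => k'; rewrite -(ler_nat R) 2!natrD natrM => ck.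
  have : 0 <= charge c by rewrite /charge sE.
  lra.
rewrite negb_or => /andP[aF aB]; have [uA zA] := pickP (c, past) sr sE aF aB.
case: (Defs.pick r (c, past)) uA zA => u z /= uA zA; rewrite /search_step.
have okF := ss_fwd sok; have okB := ss_bwd sok.
(* Common end of both kinds of iteration. The 3 units are one for the iteration and two for the
   refills; a traversed pair supplies 43, for these and the growth of the potential by 40. *)
have continue sr' hh' : search_ok c w hh' sr' -> source sr' = source sr ->
    (search_measure c sr' < search_measure c sr)%N ->
    (search_potential c sr' + 3 + 43 * size hh <=
     search_potential c sr + 43 * size hh')%N ->
    exists g, spec (dbind (refill_both R (order c) sr')
      (fun '(time, sr'') => dret R (with_search c sr'' time.+1)))
      (fun c' => bounded c' (g c') /\ (halted c' \/ decreases c' c)) g b.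
  move=> sok' src ms pot.
  pose e := reserve c + (clock c)%:R + 1 + search_reserve c w hh' (source sr).
  exists (fun c' => charge c' + (clock c')%:R + reserve c +
                    search_reserve c w hh' (source sr)).
  have -> : b = (2 + search_potential c sr')%:R + e +
      (b - (2 + search_potential c sr')%:R - e) by ring.
  apply: (spec_weaken (P := fun c' =>
    bounded c' (charge c' + (clock c')%:R + reserve c +
       search_reserve c w hh' (source sr)) /\ (halted c' \/ decreases c' c))
    (g := fun c' => charge c' + (clock c')%:R + reserve c +
       search_reserve c w hh' (source sr))).
    apply: spec_bindD (spec_refill_both R sok') _.
    move=> [t sr''] /= [sok'' set'' src'' ms''].
    have chE : charge (with_search c sr'' t.+1) = (search_potential c sr'')%:R.
      by [].
    have ckE : (clock (with_search c sr'' t.+1))%:R =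
        (clock c)%:R + t%:R + 1 :> R by rewrite /= addnS -natr1 natrD.
    apply: spec_ret; last first.
      by rewrite chE ckE natrD /e; lra.
    split; last first.
      right; right; split=> //; rewrite /remaining sE /=.
      exact: leq_ltn_trans ms'' ms.
    apply: (BoundedSearch (added := added) (w := w) (hh := hh') (sr := sr'')) => //.
    - by case: ok.
    - by case: sok''; split.
    - by rewrite src'' src.
  move=> c' H; split=> //; rewrite lerDl /e.
  move: pot; rewrite -(ler_nat R) 3!natrD 2!natrM => pot.
  move: cb; rewrite /charge sE /search_reserve; lra.
have F0 := (so_live okF (x := u)); have B0 := (so_live okB (x := z)).
have {F0} [us] : u \in seen (fwd sr) /\ ptr (fwd sr) u != [::].
  by apply: F0; rewrite inE uA.
have {B0} [zs] : z \in seen (bwd sr) /\ ptr (bwd sr) z != [::].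
  by apply: B0; rewrite inE zA.
case pz: (ptr (bwd sr) z) => [//|y rest'] _.
case pu: (ptr (fwd sr) u) => [//|x rest] _.
case: ifP => [uz|/negbT uz] /=; last first.
  have [sok' ms pot] := search_step_deactivate sok uA zA uz.
  by apply: (continue _ hh) => //; rewrite leq_add2r.
case: ifP => [_|/negbT].
  exists (fun=> b); apply: spec_ret => //; split; last by left.
  apply: BoundedHalted => //=; rewrite -natr1.
  have : 0 <= charge c by rewrite /charge sE.
  lra.
rewrite negb_or => /andP[xB yF].
have [sok' ms pot] := search_step_traverse sok uA zA uz pu pz xB yF.
apply: (continue _ _ sok' erefl ms).
rewrite mulnS addnA leq_add2r; apply: leq_trans (leq_add pot (leqnn 3)) _.
by rewrite -addnA.
Qed.

Lemma final_clock_bounded k tr (b : R) : admissible r -> bounded tr.1 b ->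
  final_clock k tr <= b.
Proof.
move=> adm; elim: k tr b => [|k IH] tr b bd.
  rewrite /=; case: bd => // [added ok _ _ _ _|added w hh sr ok _ _ sok _] cb.
    by apply: le_trans cb; rewrite lerDr; apply: reserve_ge0 ok.
  have := reserve_ge0 ok; have := search_reserve_ge sok.
  have : 0 <= (size hh)%:R :> R by [].
  have : 0 <= charge tr.1 by rewrite /charge; case: searching.
  lra.
case: (boolP (halted tr.1)) => h.
  by rewrite final_clock_halted //; apply: bounded_halted bd h.
have [g [gP _ gb]] := step_bounded adm bd h.
apply: le_trans gb => /=; apply: (expectation_le gP) => c [bc _].
exact: IH.
Qed.

(** Lexicographic induction on the arcs still to be added and on [remaining]. *)
Lemma bounded_halts tr (b : R) : admissible r -> bounded tr.1 b ->
  exists k, halts_within k tr.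
Proof.
move=> adm; have [n] := ubnP (size (todo tr.1)).
elim: n tr b => // n IHn tr b; have [p] := ubnP (remaining tr.1).
elim: p tr b => // p IHp tr b rp tn bd.
case: (boolP (halted tr.1)) => h; first by exists 0%N.
have [g [gP _ _]] := step_bounded adm bd h.
apply: halts_step; apply: almost_surely_sub gP => c [bc].
move=> [hc|[lt|[e lt]]]; first by exists 0%N.
- by apply: (IHn (c, tr.1 :: tr.2) (g c) _ bc); apply: leq_trans lt _.
- apply: (IHp (c, tr.1 :: tr.2) (g c) _ _ bc); rewrite /= ?e //.
  exact: leq_trans lt _.
Qed.

Lemma init_bounded ord : perm_eq ord (enum V) ->
  bounded (init ord arcs) (121 * q * (size arcs)%:R + #|V|%:R).
Proof.
move=> po; apply: (BoundedIdle (added := [::])) => //.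
rewrite /= lerD2r /reserve /=.
(* 121 = 72 + 49, since m^2 / q = q m and no arcs are related yet. *)
have -> : 121 * q * (size arcs)%:R =
    72 * q * (size arcs)%:R + 49 / q * (size arcs * size arcs)%:R.
  rewrite natrM -qq; field; exact: lt0r_neq0.
by rewrite lerD2l ler_wpM2l // lerBlDr lerDl.
Qed.

Lemma expected_total_time_bound ord : perm_eq ord (enum V) -> admissible r ->
  exists T : R, expected_total_time r (init ord arcs) T /\
    T <= 121 * q * (size arcs)%:R + #|V|%:R.
Proof.
move=> po adm; have bd := init_bounded po.
have [k kP] := bounded_halts (tr := (init ord arcs, [::])) adm bd.
exists (final_clock k (init ord arcs, [::])); split; last first.
  exact: final_clock_bounded.
exists k; split; first by have := surely_run (init ord arcs) 0 k; rewrite kP.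
by have := expectation_run (init ord arcs) 0 k; rewrite add0n => <-.
Qed.

End Runs.

(** * The bound in terms of m alone *)

Local Open Scope ring_scope.

(* m = Omega(n) is the hypothesis c * n <= m. *)
Theorem theorem4p6 (R : realType) (c : R) (hc : 0 < c) :
  exists C : R,
    forall (V : finType) (n m : nat) (ord : seq V) (arcs : seq (V * V))
           (r : resolver V),
      #|V| = n -> perm_eq ord (enum V) ->
      uniq arcs -> size arcs = m -> c * n%:R <= m%:R ->
      admissible r ->
      exists T : R, expected_total_time r (init ord arcs) T /\
        T <= C * m%:R `^ (3%:R / 2%:R).
Proof.
(* The summand [c^-1] pays for the initial n, which is at most m / c; 121 comes from the amortized
   analysis. *)
exists (c^-1 + 121) => V n m ord arcs r nE po au mE cnm adm.
(* For m = 0 also n = 0 and the run halts at once with clock 0; otherwise sqrt m >= 1, as the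
   analysis requires. *)
have [m0|m_gt0] := posnP m.
  have n0 : n = 0%N.
    apply/eqP; rewrite -(pnatr_eq0 R) eq_le ler0n andbT.
    by rewrite -(ler_pM2l hc) mulr0 (le_trans cnm) // m0.
  exists 0; split; last by rewrite mulr_ge0 ?powR_ge0 // addr_ge0 // invr_ge0 ltW.
  have -> : arcs = [::] by apply: size0nil; rewrite mE.
  exists 0%N; split => //.
  by rewrite expectation_ret /= nE n0.
set q : R := m%:R `^ 2^-1.
have m1 : 1 <= m%:R :> R by rewrite ler1n.
have q1 : 1 <= q.
  have -> : 1 = 1 `^ 2^-1 :> R by rewrite powR1.
  by apply: ge0_ler_powR; rewrite ?nnegrE // invr_ge0.
have qq : q * q = (size arcs)%:R.
  rewrite mE -powRD ?(gt_eqF (lt_le_trans ltr01 m1)) ?implybT //.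
  by have -> : 2^-1 + 2^-1 = 1 :> R; [field | rewrite powRr1].
have [T [TE Tb]] := expected_total_time_bound au q1 qq po adm.
exists T; split=> //; apply: le_trans Tb _.
have -> : m%:R `^ (3%:R / 2%:R) = q * m%:R.
  have -> : 3%:R / 2%:R = 2^-1 + 1 :> R by field.
  by rewrite powRD ?(gt_eqF (lt_le_trans ltr01 m1)) ?implybT // powRr1.
rewrite [leRHS]mulrDl mE nE -mulrA [leLHS]addrC lerD2r.
apply: (@le_trans _ _ (c^-1 * m%:R)); first by rewrite ler_pdivlMl.
by rewrite ler_pM2l ?invr_gt0 // ler_peMl.
Qed.
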